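(* Let $n\ge2$ and let $\lambda$ be a Young diagram with $\ell(\lambda)<n$. Suppose that $\lambda$ is of hook shape or of two-column shape. Then, as maps on $\mathsf{SST}_n(\lambda)$, $$\mathsf{s}_i\cdot\mathsf{pr}^n=\mathsf{pr}^n\cdot\mathsf{s}_i\qquad\text{for all } i\in\{1,\dots,n-1\}.$$ In particular, $\mathsf{c}\cdot\mathsf{pr}^n=\mathsf{pr}^n\cdot\mathsf{c}$, where $\mathsf{c}=\mathsf{s}_1\mathsf{s}_2\cdots\mathsf{s}_{n-1}$.
   Context: Partitions are identified with Young diagrams (English convention); $\ell(\lambda)$ is the number of positive parts. Hook shape means $\lambda=(N-m,1^m)$ with $0\le m\le N-1$; two-column shape means that the diagram has two columns ($\lambda_1=2$). $\mathsf{SST}_n(\lambda)$ is the set of semistandard tableaux of shape $\lambda$ with entries in $\{1,\dots,n\}$ (rows weakly increasing, columns strictly increasing). Products of operators are compositions, rightmost applied first. Crystal reflections: for $1\le i\le n-1$, $\mathsf{s}_i$ acts on $T\in\mathsf{SST}_n(\lambda)$ as follows. Read the entries row by row, each row left to right, from the bottom row to the top row; regard each $i+1$ as ''('' and each $i$ as '')'' and match parentheses in the usual way; the unmatched letters form a subword $i^a(i+1)^b$, which $\mathsf{s}_i$ replaces by $i^b(i+1)^a$ in the same positions. (This is the Weyl group action from the standard $U_q(\mathfrak{sl}_n)$-crystal structure.) Promotion: for $T\in\mathsf{SST}_n(\lambda)$, $\mathsf{pr}(T)$ is obtained as follows. If $T$ has no entry $n$, add 1 to every entry. Otherwise replace each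 entry $n$ by a dot; process the dots from left to right, and slide each toward the northwest by jeu de taquin: repeatedly exchange the dot with the larger of the (non-dot) entries immediately above and immediately to the left of it (with the one above in case of equality, and with the only one available if just one exists), until there is no non-dot entry above or to the left. Finally add 1 to all remaining entries and replace all dots by 1. $\mathsf{pr}$ is a bijection of $\mathsf{SST}_n(\lambda)$. *)

(* Defs.v *)
From mathcomp Require Import all_boot.

Set Implicit Arguments.
Unset Strict Implicit.
Unset Printing Implicit Defensive.

(* Partitions are weakly decreasing sequences of positive parts, so [size] is
   the length.  A tableau is the sequence of its rows, top row first. *)
Definition is_part (la : seq nat) : bool :=
  sorted geq la && all (fun p => 0 < p) la.

Definition hook_shape (la : seq nat) : Prop :=
  exists N m, m < N /\ la = (N - m) :: nseq m 1.

Definition two_column_shape (la : seq nat) : Prop := head 0 la = 2.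

Definition tableau : Type := seq (seq nat).

Definition shape_of (T : tableau) : seq nat := map size T.

(* [zip u d] pairs each entry of the lower row [d] with the one above it. *)
Definition SST (n : nat) (la : seq nat) : pred tableau := fun T =>
  [&& shape_of T == la,
      all (all (fun x => 1 <= x <= n)) T,
      all (sorted leq) T &
      sorted (fun u d => all (fun p => p.1 < p.2) (zip u d)) T].

(* Scans [w], whose first letter has position [p].  [opn] is the stack (most
   recent first) of the positions of the pending "(" = [i.+1], and [cls] lists,
   in increasing order, the positions of the unmatched ")" = [i] met so far. *)
Fixpoint bracket (i p : nat) (opn cls w : seq nat) : seq nat * seq nat :=
  match w with
  | [::] => (cls, rev opn)
  | x :: w' =>
      if x == i.+1 then bracket i p.+1 (p :: opn) cls w'
      else if x == i then
        match opn with
        | [::] => bracket i p.+1 [::] (rcons cls p) w'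
        | _ :: opn' => bracket i p.+1 opn' cls w'
        end
      else bracket i p.+1 opn cls w'
  end.

(* With [cls] and [opn] the increasing lists of positions of the [a] unmatched
   [i] and of the [b] unmatched [i.+1], the unmatched subword occupies the
   positions [cls ++ opn]; it is replaced by [i^b (i+1)^a]. *)
Definition reflect_word (i : nat) (w : seq nat) : seq nat :=
  let: (cls, opn) := bracket i 0 [::] [::] w in
  let pos := cls ++ opn in
  let new := nseq (size opn) i ++ nseq (size cls) i.+1 in
  mkseq (fun p => if p \in pos then nth 0 new (index p pos) else nth 0 w p)
        (size w).

Definition reading_word (T : tableau) : seq nat := flatten (rev T).

Definition tableau_of_word (la w : seq nat) : tableau :=
  rev (reshape (rev la) w).

Definition crystal_refl (i : nat) (T : tableau) : tableau :=
  tableau_of_word (shape_of T) (reflect_word i (reading_word T)).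

(* c = s_1 s_2 ... s_{n-1}, with s_{n-1} applied first *)
Definition coxeter (n : nat) (T : tableau) : tableau :=
  foldr crystal_refl T (iota 1 n.-1).

(* Rows and columns are numbered from 0.  Dots are encoded by 0, which is also
   what is read outside the diagram; genuine entries being positive, the value
   0 means exactly "no non-dot entry here". *)
Definition entry (T : tableau) (r c : nat) : nat := nth 0 (nth [::] T r) c.

Definition set_entry (T : tableau) (r c x : nat) : tableau :=
  set_nth [::] T r (set_nth 0 (nth [::] T r) c x).

Definition entry_above (T : tableau) (r c : nat) : nat :=
  if r is r'.+1 then entry T r' c else 0.

Definition entry_left (T : tableau) (r c : nat) : nat :=
  if c is c'.+1 then entry T r c' else 0.

(* Slides the dot at [(r, c)].  Each move decreases [r + c], so a bound
   [k = r + c] on the number of moves lets the slide run to its end. *)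
Fixpoint slide_dot (k : nat) (T : tableau) (r c : nat) : tableau :=
  if k is k'.+1 then
    let u := entry_above T r c in
    let l := entry_left T r c in
    if (u == 0) && (l == 0) then T
    else if l <= u then slide_dot k' (set_entry (set_entry T r c u) r.-1 c 0) r.-1 c
    else slide_dot k' (set_entry (set_entry T r c l) r c.-1 0) r c.-1
  else T.

Definition put_dots (n : nat) (T : tableau) : tableau :=
  map (map (fun x => if x == n then 0 else x)) T.

(* The cells [(r, c)] containing n, by increasing column; in a semistandard
   tableau there is at most one in each column.  Since dots are only exchanged
   with non-dot entries, each dot is still in its cell when its turn comes. *)
Definition dot_cells (n : nat) (T : tableau) : seq (nat * nat) :=
  [seq rc <- [seq (r, c) | c <- iota 0 (size (head [::] T)),
                           r <- iota 0 (size T)]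
  | entry T rc.1 rc.2 == n].

Definition slide_dots (n : nat) (T : tableau) : tableau :=
  foldl (fun U rc => slide_dot (rc.1 + rc.2) U rc.1 rc.2)
        (put_dots n T) (dot_cells n T).

(* The successor map adds 1 to the entries and turns the dots into 1; without
   entries n there is no dot and 1 is added to every entry of T. *)
Definition promotion (n : nat) (T : tableau) : tableau :=
  map (map S) (slide_dots n T).

(* Main.v *)
(* A tableau of either shape is determined by its content and by a boolean word.
   For a hook, the word records, for the distinct entries other than the least
   one in increasing order, which of them lie in the leg; for two columns, it
   records, for the entries of multiplicity one in increasing order, which of
   them lie in the first column.  The reflection s_i exchanges the multiplicities
   of i and i+1 and leaves the word unchanged.  Promotion rotates the content,
   and applies to the word a map depending only on the shape (a rotation for
   hooks, the promotion of ballot words for two columns) exactly when n is one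
   of the entries recorded (for hooks, when n occurs).  Hence pr^n preserves the
   content and iterates that map a number of times which depends only on the
   multiset of multiplicities, and s_i does not change the latter. *)
Require Import Defs.
From mathcomp Require Import all_boot zify.

Set Implicit Arguments.
Unset Strict Implicit.
Unset Printing Implicit Defensive.

(** * Reflections of words *)

(** The bracketing is hard to follow through a whole reading word, so each reflection is computed on
    the subword of the letters [i] and [i.+1], which is explicit: the leg of a hook holds each of
    them at most once, and two columns hold at most four of them. In two columns equal
    multiplicities make s_i the identity, which settles the case where both letters are recorded;
    otherwise at most one of them is, so exchanging their names keeps the order of the recorded
    entries. In a hook containing both letters the leg is fixed and only the row changes. On the
    promotion side, the bit of n in a hook passes to the former corner entry. In two columns, the
    dot of an n lying only in the second column turns left exactly once, at an entry x which thereby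
    changes column. Entries occurring twice add equally to both columns, so x is visible in the word
    alone: it follows the longest balanced proper prefix of the word without its last letter. *)

Definition letter (i x : nat) : bool := (x == i) || (x == i.+1).

Definition swp (i x : nat) : nat :=
  if x == i then i.+1 else if x == i.+1 then i else x.

Lemma swpK i : involutive (swp i).
Proof. by move=> x; rewrite /swp; do !case: eqP; lia. Qed.

Lemma swp_inj i : injective (swp i).
Proof. exact: inv_inj (@swpK i). Qed.

Lemma swp_id i x : ~~ letter i x -> swp i x = x.
Proof. by rewrite /letter /swp; do 2!case: eqP. Qed.

Lemma swpl i : swp i i = i.+1.
Proof. by rewrite /swp eqxx. Qed.

Lemma swpr i : swp i i.+1 = i.
Proof. by rewrite /swp eqxx; case: eqP => //; lia. Qed.

(** The scan stores positions but never compares them, so it commutes with any relabelling [g] that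
    acts as a translation on the positions still to come. *)
Lemma bracket_map i (g : nat -> nat) w p p' o c :
  (forall k, g (p + k) = p' + k) ->
  bracket i p' (map g o) (map g c) w =
  (map g (bracket i p o c w).1, map g (bracket i p o c w).2).
Proof.
elim: w p p' o c => [|x w IH] p p' o c hg /=; first by rewrite map_rev.
have hg1 k : g (p.+1 + k) = p'.+1 + k by rewrite addSnnS hg; lia.
have gp : g p = p' by have := hg 0; rewrite !addn0.
case: (x == i.+1); first by rewrite -(IH p.+1 p'.+1) //= gp.
case: (x == i); last by rewrite -(IH p.+1 p'.+1).
by case: o => [|o1 o] /=; rewrite -(IH p.+1 p'.+1) // map_rcons gp.
Qed.

(** The scan skips the neutral letter, whose only effect is to push later positions by one; [bump]
    is the relabelling that avoids its position. *)
Lemma bracket_insert i x u v p o c : ~~ letter i x ->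
  let g := bump (p + size u) in
  bracket i p (map g o) (map g c) (u ++ x :: v) =
  (map g (bracket i p o c (u ++ v)).1, map g (bracket i p o c (u ++ v)).2).
Proof.
move=> nx g; rewrite {}/g.
elim: u p o c => [|y u IH] p o c /=.
  move: nx; rewrite /letter negb_or addn0 => /andP[/negPf-> /negPf->].
  by rewrite -(@bracket_map i (bump p) v p p.+1) // => k; rewrite /bump; lia.
have gp : bump (p + (size u).+1) p = p by rewrite /bump; lia.
have := IH p.+1; rewrite addSnnS => {}IH.
case: (y == i.+1); first by rewrite -IH //= gp.
case: (y == i); last by rewrite -IH.
by case: o => [|o1 o] /=; rewrite -IH // map_rcons gp.
Qed.

Lemma size_reflect_word i w : size (reflect_word i w) = size w.
Proof. by rewrite /reflect_word; case: bracket => *; rewrite size_mkseq. Qed.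

Lemma reflect_word_insert i x u v : ~~ letter i x ->
  reflect_word i (u ++ x :: v) =
  take (size u) (reflect_word i (u ++ v)) ++
  x :: drop (size u) (reflect_word i (u ++ v)).
Proof.
move=> nx; have := bracket_insert u v 0 [::] [::] nx; rewrite add0n /=.
have sR := size_reflect_word i (u ++ v).
have sL := size_reflect_word i (u ++ x :: v).
have st : size (take (size u) (reflect_word i (u ++ v))) = size u.
  by rewrite size_take sR size_cat; case: ltnP; lia.
move=> hb; apply: (@eq_from_nth _ 0).
  by rewrite sL !size_cat /= st size_drop sR size_cat /=; lia.
rewrite sL size_cat /= => q hq; rewrite nth_cat st.
rewrite {1}/reflect_word hb; case hc: (bracket i 0 [::] [::] (u ++ v)) => [cls opn] /=.
rewrite -map_cat nth_mkseq ?size_cat //=.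
have bi : injective (bump (size u)) by move=> a b; rewrite /bump; lia.
have E q' : q' < size (u ++ v) -> nth 0 (reflect_word i (u ++ v)) q' =
  if q' \in cls ++ opn then nth 0 (nseq (size opn) i ++ nseq (size cls) i.+1)
     (index q' (cls ++ opn)) else nth 0 (u ++ v) q'.
  by move=> h; rewrite /reflect_word hc nth_mkseq.
have [h|h] := ltnP q (size u).
  have eq : q = bump (size u) q by rewrite /bump; lia.
  rewrite nth_take // E ?size_cat; last lia.
  rewrite {1 2}eq mem_map // index_map // !size_map.
  by rewrite !nth_cat h.
have [-> {q h hq}|h'] := eqVneq q (size u).
  rewrite subnn /=; case: ifP => [/mapP[q' _]|_]; first by rewrite /bump; lia.
  by rewrite nth_cat ltnn subnn.
have [q' eq hq'] : exists2 q', q = bump (size u) q' & size u <= q'.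
  by exists q.-1; rewrite /bump; lia.
have -> : q - size u = (q' - size u).+1 by rewrite eq /bump; lia.
rewrite /= nth_drop subnKC // E; last by rewrite size_cat; move: eq; rewrite /bump; lia.
rewrite eq mem_map // index_map // !size_map.
case: ifP => // _; rewrite !nth_cat /bump hq' add1n.
by rewrite !ltnNge hq' leqW //= subSn.
Qed.

(** Inverse operation to filtering: the letters of [s] fill in turn the slots of [w] that hold [i]
    or [i.+1]. If [s] is too short, the default of [head] keeps the old letter. *)
Fixpoint refill (i : nat) (w s : seq nat) : seq nat :=
  if w is x :: w' then
    if letter i x then head x s :: refill i w' (behead s)
    else x :: refill i w' s
  else [::].

(** Only the part not yet scanned is filtered; the prefix [u] keeps its neutral letters. Each step
    of the induction on [v] then deals with one letter, by moving it into [u] or by inserting it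
    back. *)
Lemma reflect_word_cat_refill i u v :
  let R := reflect_word i (u ++ filter (letter i) v) in
  reflect_word i (u ++ v) = take (size u) R ++ refill i v (drop (size u) R).
Proof.
elim: v u => [|x v IH] u /=.
  by rewrite !cats0 take_oversize // size_reflect_word.
case: ifP => hx; last first.
  rewrite reflect_word_insert ?hx // IH.
  set R := reflect_word _ (u ++ filter _ _).
  have st : size (take (size u) R) = size u.
    by rewrite size_take size_reflect_word size_cat; case: ltnP; lia.
  by rewrite take_cat drop_cat st ltnn subnn /= take0 cats0 drop0.
rewrite -cat_rcons IH cat_rcons size_rcons.
set R := reflect_word _ _.
have hs : size u < size R by rewrite size_reflect_word size_cat /=; lia.
by rewrite (take_nth x) // cat_rcons (drop_nth x hs).
Qed.

Lemma reflect_wordE i w :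
  reflect_word i w = refill i w (reflect_word i (filter (letter i) w)).
Proof. by have := reflect_word_cat_refill i [::] w; rewrite /= take0 drop0. Qed.

Lemma refill_cat i c c' w s : size c' = size (filter (letter i) c) ->
  refill i (c ++ w) (c' ++ s) = refill i c c' ++ refill i w s.
Proof.
elim: c c' => [|x c IH] [|y c'] //=; case: ifP => _ //=.
- by move=> /(IH [::]) /= ->.
- by case=> /IH ->.
- by move=> /(IH (y :: c')) /= ->.
Qed.

Lemma refill_neutral i c s : filter (letter i) c = [::] -> refill i c s = c.
Proof. by elim: c => //= x c IH; case: ifP => // _ /IH ->. Qed.

Lemma refill_letters i c c' : all (letter i) c -> size c' = size c ->
  refill i c c' = c'.
Proof.
elim: c c' => [|x c IH] [|y c'] //= /andP[-> hc] [h] /=.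
by rewrite IH.
Qed.

Lemma refill_id i c : refill i c (filter (letter i) c) = c.
Proof. by elim: c => //= x c IH; case: (letter i x) => /=; rewrite IH. Qed.

Lemma refill_map (X : Type) i (phi psi : X -> nat) (w : seq X) :
  (forall x, ~~ letter i (phi x) -> psi x = phi x) ->
  refill i (map phi w) (map psi (filter (fun x => letter i (phi x)) w)) =
  map psi w.
Proof.
move=> h; elim: w => //= x w IH; case hx: (letter i (phi x)) => /=; first by rewrite IH.
by rewrite IH h ?hx.
Qed.

(** The elements of [w] may carry more than a letter, such as the column they come from; [phi] reads
    the letter before the reflection and [psi] the one after it. The effect of a reflection can thus
    be stated cell by cell and checked on a short word. *)
Lemma reflect_word_map (X : Type) i (phi psi : X -> nat) (w : seq X) :
  (forall x, ~~ letter i (phi x) -> psi x = phi x) ->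
  let w' := filter (fun x => letter i (phi x)) w in
  reflect_word i (map phi w') = map psi w' ->
  reflect_word i (map phi w) = map psi w.
Proof. by move=> h /= hw; rewrite reflect_wordE filter_map hw refill_map. Qed.

Lemma index_in_iota m k q : m <= q < m + k -> index q (iota m k) = q - m.
Proof.
move=> hq; rewrite -{1}(subnKC (_ : m <= q)); last by lia.
by rewrite -(nth_iota 0 m (_ : q - m < k)) ?index_uniq ?size_iota ?iota_uniq //; lia.
Qed.

Lemma bracket_open i a p o c :
  bracket i p o c (nseq a i.+1) = (c, rev o ++ iota p a).
Proof.
elim: a p o => [|a IH] p o /=; first by rewrite cats0.
by rewrite eqxx IH rev_cons cat_rcons.
Qed.

Lemma bracket_close_open i a b p c :
  bracket i p [::] c (nseq a i ++ nseq b i.+1) =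
  (c ++ iota p a, iota (p + a) b).
Proof.
elim: a p c => [|a IH] p c /=.
  by rewrite bracket_open cats0 addn0.
by rewrite eqxx ltn_eqF // IH cat_rcons addSnnS.
Qed.

Lemma reflect_close_open i a b :
  reflect_word i (nseq a i ++ nseq b i.+1) = nseq b i ++ nseq a i.+1.
Proof.
rewrite /reflect_word bracket_close_open /= !size_iota add0n.
rewrite -iotaD; apply: (@eq_from_nth _ 0).
  by rewrite size_mkseq !size_cat !size_nseq addnC.
rewrite size_mkseq => q hq; rewrite nth_mkseq //.
have hq' : q < a + b by move: hq; rewrite size_cat !size_nseq.
by rewrite mem_iota hq' /= index_in_iota // subn0.
Qed.

(** The two leading letters match each other and drop out. This is what is read when the leg of a
    hook, or the first of two columns, contains both letters. *)
Lemma reflect_pair_close_open i a b :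
  reflect_word i (i.+1 :: i :: nseq a i ++ nseq b i.+1) =
  i.+1 :: i :: nseq b i ++ nseq a i.+1.
Proof.
rewrite /reflect_word /= eqxx ltn_eqF // eqxx bracket_close_open /= !size_iota.
rewrite -iotaD; apply: (@eq_from_nth _ 0).
  by rewrite size_mkseq /= !size_cat !size_nseq addnC.
rewrite size_mkseq => q hq; rewrite nth_mkseq //.
have hq' : q < 2 + (a + b) by move: hq; rewrite /= size_cat !size_nseq.
rewrite mem_iota hq' andbT; case: q hq hq' => [|[|q]] //= hq hq'.
by rewrite index_in_iota //= !subSS subn0.
Qed.

(** [W] is the whole word and [w] its unread end. Matching removes one [i] and one [i.+1] together,
    so the difference of the numbers of unmatched letters is that of the multiplicities; the
    equation states this without subtraction. *)
Lemma bracket_inv i W w p o c : drop p W = w ->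
  all (fun q => nth 0 W q == i.+1) o -> all (fun q => nth 0 W q == i) c ->
  let r := bracket i p o c w in
  [/\ all (fun q => nth 0 W q == i) r.1, all (fun q => nth 0 W q == i.+1) r.2
    & size r.1 + count_mem i.+1 w + size o = size r.2 + count_mem i w + size c].
Proof.
elim: w p o c => [|x w IH] p o c hw ho hc /=.
  by rewrite all_rev size_rev; split=> //; lia.
have hx : nth 0 W p = x by rewrite -[p]addn0 -nth_drop hw.
have hw' : drop p.+1 W = w by rewrite -add1n -drop_drop hw /= drop0.
case: (eqVneq x i.+1) => [ex|nx].
  have [||h1 h2 h3] := IH p.+1 (p :: o) c hw'; rewrite /= ?ho ?hc ?hx ?ex ?eqxx //.
  by split=> //; move: h3 => /=; rewrite [i.+1 == i]gtn_eqF //; lia.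
case: (eqVneq x i) => [ex|nx'].
  case: o ho => [|o1 o] /= ho.
    have [||h1 h2 h3] := IH p.+1 [::] (rcons c p) hw'; rewrite ?all_rcons ?hx ?ex ?eqxx //.
    by split=> //; move: h3; rewrite size_rcons /=; lia.
  have [||h1 h2 h3] := IH p.+1 o c hw'; rewrite ?hc //; first by case/andP: ho.
  by split=> //; rewrite add0n add1n !addnS !addSn h3.
by have [||h1 h2 h3] := IH p.+1 o c hw'; rewrite ?ho ?hc.
Qed.

(** Equal multiplicities leave equally many unmatched letters of both kinds, so the unmatched
    subword is replaced by itself. *)
Lemma reflect_word_balanced i w :
  count_mem i w = count_mem i.+1 w -> reflect_word i w = w.
Proof.
move=> hw; rewrite /reflect_word.
have [//|//|//|] := @bracket_inv i w w 0 [::] [::]; first by rewrite drop0.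
case: bracket => cls opn /= hc ho; rewrite hw => hs.
have {hs} hs : size opn = size cls by move: hs; rewrite !addn0 => /addIn->.
apply: (@eq_from_nth _ 0); rewrite size_mkseq // => q hq; rewrite nth_mkseq //.
case: ifP => //; rewrite mem_cat index_cat.
case: ifP => /= hq1 hq2.
  by rewrite nth_cat size_nseq hs index_mem hq1 nth_nseq index_mem hq1 (eqP (allP hc _ hq1)).
rewrite nth_cat size_nseq hs ltnNge leq_addr /= addKn nth_nseq -hs index_mem hq2.
by rewrite (eqP (allP ho _ hq2)).
Qed.

Lemma sorted_letter_blocks i a b u v : sorted leq u -> sorted leq v ->
  all (fun x => x < i) u -> all (fun x => i.+1 < x) v ->
  sorted leq (u ++ (nseq a i ++ nseq b i.+1) ++ v).
Proof.
move=> su sv /allP hu /allP hv.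
have hn c x : sorted leq (nseq c x) by elim: c => // -[|c] //= ->; rewrite leqnn.
rewrite sorted_pairwise; last exact: leq_trans.
rewrite !pairwise_cat -!sorted_pairwise; try exact: leq_trans.
rewrite su sv !hn !andbT /=; apply/and3P; split; apply/allrelP => x y.
- by move=> /hu hx; rewrite !mem_cat !mem_nseq => /orP[|/hv]; lia.
- by rewrite mem_cat !mem_nseq => hx /hv; lia.
- by rewrite !mem_nseq; lia.
Qed.

Lemma filter_letter_sorted i s : sorted leq s ->
  s = filter (fun x => x < i) s ++ (nseq (count_mem i s) i ++
      nseq (count_mem i.+1 s) i.+1) ++ filter (fun x => i.+1 < x) s.
Proof.
move=> hs; apply: (sorted_eq leq_trans anti_leq) => //.
  by apply: sorted_letter_blocks; rewrite ?filter_all ?sorted_filter //; exact: leq_trans.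
apply/allP => x _ /=; apply/eqP.
rewrite !count_cat !count_nseq !count_filter /=.
elim: (s) => [|y s' IH]; first by rewrite /= !muln0.
move: IH => /=; move: (count_mem x s') (count _ _) (count_mem i s')
  (count_mem i.+1 s') (count _ _) => a b c d e.
case: (eqVneq i x) => hi; case: (eqVneq i.+1 x) => hj;
  case: (eqVneq y x) => hy; case: (eqVneq y i) => hyi;
  case: (eqVneq y i.+1) => hyj //=; lia.
Qed.

(** With one of the two letters absent nothing is matched, and every occurrence of the other is
    renamed. *)
Lemma reflect_word_swp i w : ~~ ((i \in w) && (i.+1 \in w)) ->
  reflect_word i w = map (swp i) w.
Proof.
move=> h; rewrite -{1}[w]map_id; apply: reflect_word_map => [x|].
  exact: swp_id.
rewrite map_id.
have [hi|hi] := boolP (i \in w).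
  have hi1 : i.+1 \notin w by move: h; rewrite hi.
  have -> : filter (letter i) w = nseq (count_mem i w) i.
    have -> : filter (letter i) w = filter (pred1 i) w.
      apply: eq_in_filter => x hx; rewrite /letter /=.
      by rewrite orbC; case: eqP => // ex; rewrite -ex hx in hi1.
    by rewrite -size_filter; apply/all_pred1P; exact: filter_all.
  have := reflect_close_open i (count_mem i w) 0; rewrite /= cats0 => ->.
  by rewrite map_nseq swpl.
have -> : filter (letter i) w = nseq (count_mem i.+1 w) i.+1.
  have -> : filter (letter i) w = filter (pred1 i.+1) w.
    apply: eq_in_filter => x hx; rewrite /letter /=.
    by case: eqP => // ex; rewrite -ex hx in hi.
  by rewrite -size_filter; apply/all_pred1P; exact: filter_all.
have := reflect_close_open i 0 (count_mem i.+1 w); rewrite /= cats0 => ->.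
by rewrite map_nseq swpr.
Qed.

(** * Slides of dots *)

(* [D] is the first column and [R] lists the remainders of the rows; missing
   remainders are empty. *)
Fixpoint cons_col (X : Type) (D : seq X) (R : seq (seq X)) : seq (seq X) :=
  if D is a :: D' then (a :: head [::] R) :: cons_col D' (behead R) else [::].

Lemma size_cons_col (X : Type) (D : seq X) R : size (cons_col D R) = size D.
Proof. by elim: D R => //= a D IH R; rewrite IH. Qed.

Lemma nth_cons_col (X : Type) (x0 : X) (D : seq X) R r : r < size D ->
  nth [::] (cons_col D R) r = nth x0 D r :: nth [::] R r.
Proof.
elim: D R r => //= a D IH R [|r] /=; first by rewrite nth0.
by rewrite ltnS => /IH ->; rewrite nth_behead.
Qed.

Lemma map_cons_col (X Y : Type) (h : X -> Y) (D : seq X) R :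
  map (map h) (cons_col D R) = cons_col (map h D) (map (map h) R).
Proof. by elim: D R => //= a D IH [|r R]; rewrite IH. Qed.

Lemma entry_cons_col0 D R r : entry (cons_col D R) r 0 = nth 0 D r.
Proof.
rewrite /entry; case: (ltnP r (size D)) => hr; first by rewrite (nth_cons_col 0).
by rewrite (nth_default [::]) ?size_cons_col // [RHS]nth_default.
Qed.

Lemma entry_cons_colS D R r c : r < size D ->
  entry (cons_col D R) r c.+1 = nth 0 (nth [::] R r) c.
Proof. by move=> hr; rewrite /entry (nth_cons_col 0). Qed.

Lemma set_entry_cons_col0 D R r x : r < size D ->
  set_entry (cons_col D R) r 0 x = cons_col (set_nth 0 D r x) R.
Proof.
rewrite /set_entry; elim: D R r => //= a D IH R [|r] //=.
by rewrite ltnS => /IH ->.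
Qed.

Lemma set_entry_cons_colS D R r c x : r < size D ->
  set_entry (cons_col D R) r c.+1 x =
  cons_col D (set_nth [::] R r (set_nth 0 (nth [::] R r) c x)).
Proof.
rewrite /set_entry; elim: D R r => //= a D IH R [|r] //=.
  by case: R.
rewrite ltnS => /(IH (behead R)) ->; rewrite nth_behead.
by case: R => //=; case: r.
Qed.

Lemma set_nth_cat_size (X : Type) (x0 : X) D E x y :
  set_nth x0 (D ++ x :: E) (size D) y = D ++ y :: E.
Proof. by elim: D => //= a D ->. Qed.

(** Nothing lies to the left of the first column, so the dot climbs to the top and pushes [D] down
    by one, whatever the other columns contain. *)
Lemma slide_dot_col0 D E R : all (ltn 0) D ->
  slide_dot (size D) (cons_col (D ++ 0 :: E) R) (size D) 0 =
  cons_col (0 :: D ++ E) R.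
Proof.
elim/last_ind: D E => [|D x IH] E // .
rewrite all_rcons size_rcons => /andP[x0 hD].
rewrite [slide_dot _ _ _ _]/= entry_cons_col0 cat_rcons nth_cat ltnn subnn /=.
rewrite gtn_eqF //= set_entry_cons_col0; last by rewrite size_cat /=; lia.
rewrite -cat_rcons -(size_rcons D x) set_nth_cat_size cat_rcons.
rewrite set_entry_cons_col0; last by rewrite size_cat /=; lia.
by rewrite set_nth_cat_size IH // cat_rcons.
Qed.

(** The [m] leading zeros are dots that have already arrived; the moving dot stops against them. *)
Lemma slide_dot_row0 m D E L : all (ltn 0) D ->
  slide_dot (m + size D) ((nseq m 0 ++ D ++ 0 :: E) :: L) 0 (m + size D) =
  (nseq m 0 ++ 0 :: D ++ E) :: L.
Proof.
elim/last_ind: D E => [|D x IH] E.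
  (* The left neighbour is an earlier dot or lies outside the diagram. Both read as 0, so the slide
     ends before its bound on moves is exhausted. *)
  move=> _; rewrite addn0; case: m => //= m; rewrite /entry /=.
  by rewrite -[0 :: nseq m 0 ++ _]/((nseq m.+1 0) ++ _) nth_cat size_nseq ltnSn nth_nseq ltnSn.
rewrite all_rcons size_rcons => /andP[x0 hD].
rewrite addnS [slide_dot _ _ _ _]/= /entry [nth [::] _ _]/= cat_rcons.
have -> : nth 0 (nseq m 0 ++ D ++ x :: 0 :: E) (m + size D) = x.
  by rewrite catA nth_cat size_cat size_nseq ltnn subnn.
rewrite gtn_eqF // leqNgt (x0 : 0 < x) /= /set_entry /=.
have -> : set_nth 0 (nseq m 0 ++ D ++ x :: 0 :: E) (m + size D).+1 x =
          (nseq m 0 ++ D) ++ x :: x :: E.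
  have -> : (m + size D).+1 = size (nseq m 0 ++ rcons D x).
    by rewrite size_cat size_nseq size_rcons addnS.
  by rewrite -cat_rcons catA set_nth_cat_size -!catA cat_rcons.
have {2}-> : m + size D = size (nseq m 0 ++ D) by rewrite size_cat size_nseq.
by rewrite set_nth_cat_size -catA IH // cat_rcons.
Qed.

(** Each dot that passes over [D] shifts [D] to the right by one, so the next dot is again adjacent
    to [D], with one more zero in front. *)
Lemma slide_dots_row0 m k D L : all (ltn 0) D ->
  foldl (fun U rc => slide_dot (rc.1 + rc.2) U rc.1 rc.2)
    ((nseq m 0 ++ D ++ nseq k 0) :: L) [seq (0, c) | c <- iota (m + size D) k] =
  (nseq (m + k) 0 ++ D) :: L.
Proof.
move=> hD; elim: k m => [|k IH] m /=; first by rewrite addn0 cats0.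
rewrite slide_dot_row0 //= -cat_rcons.
have -> : rcons (nseq m 0) 0 = nseq m.+1 0.
  by elim: (m) => //= m' ->.
by rewrite -addSnnS -(IH m.+1).
Qed.

(** * Commutation from an encoding *)

(** As [swp i] permutes 1, ..., n, the number of iterations performed by the n promotions is the
    same before and after a reflection. *)
Lemma count_swp_iota i n (P : pred nat) : 0 < i < n ->
  count (fun x => P (swp i x)) (iota 1 n) = count P (iota 1 n).
Proof.
move=> hi; rewrite -(count_map (swp i) P); apply/permP/uniq_perm.
- by rewrite map_inj_uniq ?iota_uniq //; exact: swp_inj.
- exact: iota_uniq.
move=> x; rewrite -{1}(swpK i x) mem_map; last exact: swp_inj.
by rewrite !mem_iota /swp; do 2?case: eqP; lia.
Qed.

(** The exchange reverses only the pair [i], [i.+1]; since these are not both selected, the renamed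
    list is still increasing. *)
Lemma filter_swp_iota i n (P : pred nat) : 0 < i < n -> ~~ (P i && P i.+1) ->
  filter (fun x => P (swp i x)) (iota 1 n) = map (swp i) (filter P (iota 1 n)).
Proof.
move=> hi hP.
have -> : n = i.-1 + (2 + (n - i.+1)) by lia.
rewrite !iotaD !filter_cat !map_cat.
have hout (s : seq nat) : all (fun x => ~~ letter i x) s ->
    filter (fun x => P (swp i x)) s = map (swp i) (filter P s).
  elim: s => //= x s IH /andP[hx /IH ->]; rewrite swp_id //.
  by case: ifP => //=; rewrite swp_id.
congr (_ ++ (_ ++ _)).
- apply: hout; apply/allP => x; rewrite mem_iota /letter; lia.
- have -> : iota (1 + i.-1) 2 = [:: i; i.+1] by rewrite (_ : 1 + i.-1 = i) //; lia.
  rewrite /= swpl swpr; move: hP.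
  by case: (P i); case: (P i.+1); rewrite //= ?swpl ?swpr.
- apply: hout; apply/allP => x; rewrite mem_iota /letter; lia.
Qed.

(** Common frame of the two shapes: [mu] is the content, [f] the boolean word, [d] the map induced
    on words, and [act] decides from the multiplicity of n whether [d] is applied. For hooks [act]
    tests for a positive multiplicity, for two columns for multiplicity one. *)
Section Encoding.

Variables (X : Type) (n : nat) (tab : X -> tableau) (good : X -> Prop).
Variables (mu : X -> nat -> nat) (f : X -> seq bool).
Variables (d : seq bool -> seq bool) (act : pred nat).

Hypothesis encoding_inj : forall a b, good a -> good b ->
  (forall x, 0 < x <= n -> mu a x = mu b x) -> f a = f b -> a = b.

Hypothesis promotion_encoding : forall a, good a -> exists b,
  [/\ good b, promotion n (tab a) = tab b,
      forall x, 0 < x < n -> mu b x.+1 = mu a x, mu b 1 = mu a n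
    & f b = if act (mu a n) then d (f a) else f a].

Hypothesis crystal_refl_encoding : forall i a, 0 < i < n -> good a ->
  exists b, [/\ good b, crystal_refl i (tab a) = tab b,
    forall x, 0 < x <= n -> mu b x = mu a (swp i x) & f b = f a].

(** After k promotions an original letter x has become x + k, or x + k - n if it has wrapped around.
    The letters that were n in turn are therefore the original n, n - 1, ..., n - k + 1, which is
    the range of the count. *)
Lemma iter_promotion_encoding k a : k <= n -> good a -> exists b,
  [/\ good b, iter k (promotion n) (tab a) = tab b,
      forall x, 0 < x <= n - k -> mu b (x + k) = mu a x,
      forall x, n - k < x <= n -> mu b (x + k - n) = mu a x
    & f b = iter (count (fun x => act (mu a x)) (iota (n - k).+1 k)) d (f a)].
Proof.
move=> hk ha; elim: k hk => [_|k IH hk].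
  by exists a; split=> //= x hx; [rewrite addn0|lia].
have [b [gb eb m1 m2 fb]] := IH (ltnW hk).
have [c [gc ec m3 m4 fc]] := promotion_encoding gb.
have hn : mu b n = mu a (n - k) by rewrite -m1 ?subnK //; lia.
exists c; split=> //.
- by rewrite iterS eb.
- by move=> x hx; rewrite addnS m3 ?m1 //; lia.
- move=> x hx; have [->|hx'] := eqVneq x (n - k).
    by rewrite (_ : _ - n = 1) ?m4 //; lia.
  by rewrite (_ : x + k.+1 - n = (x + k - n).+1) ?m3 ?m2 //; lia.
have -> : (n - k.+1).+1 = n - k by lia.
rewrite fc hn fb /=.
by case: (act _).
Qed.

Lemma crystal_refl_iter_promotion i a : 0 < i < n -> good a ->
  crystal_refl i (iter n (promotion n) (tab a)) =
  iter n (promotion n) (crystal_refl i (tab a)).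
Proof.
move=> hi ga.
have [b [gb eb _ mb fb]] := iter_promotion_encoding (leqnn n) ga.
have [c [gc ec mc fc]] := crystal_refl_encoding hi gb.
have [b' [gb' eb' mb' fb']] := crystal_refl_encoding hi ga.
have [c' [gc' ec' _ mc' fc']] := iter_promotion_encoding (leqnn n) gb'.
rewrite eb ec eb' ec'; congr tab; apply: encoding_inj => //.
  move=> x hx; have hs : 0 < swp i x <= n by rewrite /swp; do 2?case: eqP; lia.
  have := mb (swp i x); have := mc' x; rewrite !addnK subnn => h1 h2.
  by rewrite mc // h2 // h1 // mb'.
rewrite fc fb fc' fb' subnn; congr iter.
rewrite -(count_swp_iota _ hi); apply: eq_in_count => x.
by rewrite mem_iota add1n ltnS => hx; rewrite mb'.
Qed.

Lemma coxeter_iter_promotion a : good a ->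
  coxeter n (iter n (promotion n) (tab a)) =
  iter n (promotion n) (coxeter n (tab a)).
Proof.
move=> ga; rewrite /coxeter.
have: all (fun i => 0 < i < n) (iota 1 n.-1).
  by apply/allP => i; rewrite mem_iota; lia.
move: (iota _ _) => l hl.
(* Every intermediate tableau has to stay encoded, since the commutation with one reflection is
   known only there. *)
suff [b [_ -> ->]] : exists b, [/\ good b, foldr crystal_refl (tab a) l = tab b
  & foldr crystal_refl (iter n (promotion n) (tab a)) l =
    iter n (promotion n) (tab b)] by [].
elim: l hl => [|i l IH] /=; first by exists a.
move=> /andP[hi /IH[b [gb -> ->]]].
have [c [gc ec _ _]] := crystal_refl_encoding hi gb.
by exists c; rewrite crystal_refl_iter_promotion // ec.
Qed.

End Encoding.

(** * Hooks *)

(** Shape and reading word determine a tableau, so reflections can be compared on words. *)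
Lemma crystal_refl_eq i T T' : shape_of T' = shape_of T ->
  reflect_word i (reading_word T) = reading_word T' -> crystal_refl i T = T'.
Proof.
move=> hs hw; rewrite /crystal_refl hw -hs /tableau_of_word /shape_of.
by rewrite -map_rev flattenK revK.
Qed.

Lemma sorted_ltn_max n s : sorted ltn s -> all (fun x => x <= n) s -> n \in s ->
  exists2 s0, s = rcons s0 n & all (fun x => x < n) s0.
Proof.
case/lastP: s => // s x hs; rewrite all_rcons => /andP[hx hall].
have hlt : all (fun y => y < x) s.
  move: hs; rewrite sorted_pairwise; last exact: ltn_trans.
  by rewrite -cats1 pairwise_cat allrel1r => /andP[].
rewrite mem_rcons inE => /orP[/eqP->|hn]; first by exists s.
by have := allP hlt _ hn; lia.
Qed.

Lemma filter_index_cat_nseq n (D : seq nat) k : n \notin D ->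
  [seq c <- iota 0 (size (D ++ nseq k n)) | nth 0 (D ++ nseq k n) c == n] =
  iota (size D) k.
Proof.
move=> hD; rewrite size_cat size_nseq iotaD filter_cat add0n.
rewrite (eq_in_filter (a2 := pred0)) ?filter_pred0 /=; last first.
  move=> c; rewrite mem_iota /= nth_cat => hc; rewrite hc /=.
  by apply/eqP => e; move: hD; rewrite -e mem_nth.
apply/all_filterP/allP => c; rewrite mem_iota nth_cat => /andP[h1 h2].
by rewrite ltnNge h1 /= nth_nseq (_ : _ < k) //; lia.
Qed.

Definition hook_tab (X : seq nat * seq nat) : tableau :=
  X.1 :: [seq [:: x] | x <- X.2].

Definition in_range (n : nat) : pred (seq nat) := all (fun x => 0 < x <= n).

(** The corner belongs to the row [X.1]; the [path] condition is the strict increase of the whole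
    first column. *)
Definition hook_good (n : nat) (X : seq nat * seq nat) : Prop :=
  [/\ 0 < size X.1, sorted leq X.1, path ltn (head 0 X.1) X.2, in_range n X.1
    & in_range n X.2].

Definition mult (X : seq nat * seq nat) (x : nat) : nat :=
  count_mem x (X.1 ++ X.2).

Definition hook_support (n : nat) X := [seq x <- iota 1 n | 0 < mult X x].

Definition hook_code (n : nat) (X : seq nat * seq nat) : seq bool :=
  [seq x \in X.2 | x <- behead (hook_support n X)].

Lemma SST_hook n la T : hook_shape la -> T \in SST n la ->
  exists2 X, hook_good n X & T = hook_tab X.
Proof.
move=> [N [m [hm ->]]]; rewrite unfold_in => /and4P[/eqP hs hr hrow hcol].
case: T hs hr hrow hcol => // row L [hrow hL] /= /andP[r1 r2] /andP[o1 _] hp.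
have eL : L = [seq [:: x] | x <- map (head 0) L].
  elim: L m hL {hm hrow r2 hp} => // r L IH [|m] //= [hr /IH <-].
  by case: r hr => // x [].
exists (row, map (head 0) L); last by rewrite /hook_tab /= -eL.
move: r2 hp; rewrite {1 2}eL; move: (map _ L) => l r2 hp.
split=> //=; first by rewrite hrow subn_gt0.
- have: 0 < size row by rewrite hrow subn_gt0.
  case: row hp {hrow r1 o1} => // a r /= hp _.
  elim: l a r hp {r2} => //= x l IH a r /andP[h /IH ->].
  by move: h; case: r => [|b r] /=; rewrite !andbT.
- by elim: l r2 {hp} => //= x l IH; rewrite andbT => /andP[-> /IH].
Qed.

Lemma mult_gt0 X x : (0 < mult X x) = (x \in X.1) || (x \in X.2).
Proof. by rewrite /mult -has_count has_pred1 mem_cat. Qed.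

Lemma mem_hook_support n X x : hook_good n X ->
  (x \in hook_support n X) = (x \in X.1) || (x \in X.2).
Proof.
case=> _ _ _ r1 r2; rewrite mem_filter mult_gt0 mem_iota.
case: (boolP (x \in X.1)) => [/(allP r1)|_] /=; first by lia.
by case: (boolP (x \in X.2)) => [/(allP r2)|_] /=; lia.
Qed.

Lemma hook_min n X x : hook_good n X -> (x \in X.1) || (x \in X.2) ->
  head 0 X.1 <= x.
Proof.
case=> h0 o1 o2 _ _ /orP[] hx.
  case: (X.1) h0 o1 hx => //= a r _.
  rewrite path_sortedE; last exact: leq_trans.
  by case/andP=> /allP ha _; rewrite inE => /orP[/eqP->|/ha].
move: o2; rewrite path_sortedE; last exact: ltn_trans.
by case/andP=> /allP /(_ _ hx) /= ha _; exact: ltnW.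
Qed.

(** The corner is minimal in its row and in its column, so the entry dropped by [behead] is the
    corner entry and never occurs in the leg. *)
Lemma hook_support_head n X : hook_good n X ->
  hook_support n X = head 0 X.1 :: behead (hook_support n X).
Proof.
move=> gX; set a := head 0 X.1.
have ha : a \in X.1 by case: gX; rewrite /a; case: (X.1) => //= *; exact: mem_head.
have has : a \in hook_support n X by rewrite mem_hook_support // ha.
have : sorted ltn (hook_support n X).
  by apply: sorted_filter; [exact: ltn_trans|exact: iota_ltn_sorted].
have hmin x : x \in hook_support n X -> a <= x.
  by rewrite (mem_hook_support _ gX) => /(hook_min gX).
case: (hook_support n X) has hmin => //= b s; rewrite inE => /orP[/eqP-> //|hs] hm.
rewrite path_sortedE; last exact: ltn_trans.
by case/andP=> /allP /(_ _ hs) /=; have := hm b (mem_head _ _); lia.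
Qed.

Lemma mem_leg_behead n X x : hook_good n X -> x \in X.2 ->
  x \in behead (hook_support n X).
Proof.
move=> gX hx; have := mem_hook_support x gX; rewrite hx orbT hook_support_head //.
rewrite inE => /orP[/eqP e|//]; case: gX => _ _ o _ _; move: o.
rewrite path_sortedE; last exact: ltn_trans.
by case/andP=> /allP /(_ _ hx) /=; rewrite e ltnn.
Qed.

(** The word determines the leg; removing the leg from the content leaves the content of the row,
    which is sorted. *)
Lemma hook_encoding_inj n X Y : hook_good n X -> hook_good n Y ->
  (forall x, 0 < x <= n -> mult X x = mult Y x) ->
  hook_code n X = hook_code n Y -> X = Y.
Proof.
move=> gX gY hmu hc.
have hsup : hook_support n X = hook_support n Y.
  by apply: eq_in_filter => x; rewrite mem_iota => hx; rewrite hmu //; lia.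
move: hc; rewrite /hook_code hsup => /eq_in_map hc.
have hleg : X.2 = Y.2.
  apply: (irr_sorted_eq ltn_trans ltnn).
  - by case: gX => _ _ /path_sorted.
  - by case: gY => _ _ /path_sorted.
  move=> x; apply/idP/idP => hx.
    by rewrite -hc // -hsup; exact: mem_leg_behead.
  by rewrite hc //; exact: mem_leg_behead.
have hrow : X.1 = Y.1.
  apply: (sorted_eq leq_trans anti_leq); [by case: gX|by case: gY|].
  apply/allP => x; rewrite mem_cat => hx.
  have /hmu : 0 < x <= n.
    by case/orP: hx; [case: gX|case: gY] => _ _ _ /allP h _ /h.
  by rewrite /mult !count_cat hleg => /addIn h; apply/eqP.
by case: X Y hrow hleg {gX gY hmu hc hsup} => [? ?] [? ?] /= -> ->.
Qed.

(** * Promotion of hooks *)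

Lemma hook_dot_cells n X k D : 0 < n -> hook_good n X ->
  X.1 = D ++ nseq k n -> n \notin D ->
  dot_cells n (hook_tab X) =
  (if n \in X.2 then [:: (size X.2, 0)] else [::]) ++
  [seq (0, c) | c <- iota (size D) k].
Proof.
move=> n0 gX hX hD; rewrite -(filter_index_cat_nseq k hD) -hX /dot_cells /=.
rewrite size_map; set E := entry (hook_tab X).
have E0 c : E 0 c = nth 0 X.1 c by [].
have ES r c : E r.+1 c = nth 0 (if c is 0 then X.2 else [::]) r.
  rewrite /E /entry /=; case: (ltnP r (size X.2)) => hr.
    by rewrite (nth_map 0) //; case: c => //= c; rewrite !nth_nil.
  by rewrite [nth [::] _ r]nth_default ?size_map // nth_nil; case: c => [|c]; rewrite ?nth_nil // nth_default.
have [N eN] : exists N, size X.1 = N.+1 by case: gX; case: (size X.1) => // N; exists N.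
rewrite eN /= !filter_cat.
(* Beyond the first column only row 0 meets the diagram; the cells below read 0, which is not n. *)
have -> : [seq rc <- flatten [seq (0, c) :: [seq (r, c) | r <- iota 1 (size X.2)]
            | c <- iota 1 N] | E rc.1 rc.2 == n] = 
          [seq (0, c) | c <- [seq c <- iota 1 N | nth 0 X.1 c == n]].
  have : all (ltn 0) (iota 1 N) by apply/allP => c; rewrite mem_iota => /andP[].
  elim: (iota 1 N) => //= c s IH /andP[hc /IH {}IH].
  rewrite filter_cat IH E0 filter_map (eq_in_filter (a2 := pred0)).
    by rewrite filter_pred0 /=; case: ifP.
  move=> [|r]; rewrite mem_iota // => _; rewrite /= ES.
  by case: c hc => // c _; rewrite nth_nil /= ltn_eqF.
have -> : [seq rc <- [seq (r, 0) | r <- iota 1 (size X.2)] | E rc.1 rc.2 == n] =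
          if n \in X.2 then [:: (size X.2, 0)] else [::].
  have -> : iota 1 (size X.2) = map S (iota 0 (size X.2)) by rewrite -(iotaDl 1 0).
  rewrite -map_comp filter_map.
  rewrite (eq_filter (a2 := fun r => nth 0 X.2 r == n)); last first.
    by move=> r /=; rewrite ES.
  case: ifP => [hn|/negbT hn]; last first.
    by have := filter_index_cat_nseq 0 hn; rewrite cats0 => ->.
  case: gX => _ _ /path_sorted o _ r2.
  have [|s0 es h0] := sorted_ltn_max o _ hn.
    by apply: sub_all r2 => x /andP[].
  have hs0 : n \notin s0 by apply/negP => /(allP h0); rewrite ltnn.
  by have := filter_index_cat_nseq 1 hs0; rewrite cats1 -es => ->; rewrite /= es size_rcons.
(* If the corner is n, the leg, whose entries are larger than the corner, cannot contain n, so the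
   dot of the leg never competes with one in the corner. *)
rewrite E0; case: eqP => [e|_]; last by [].
case: ifP => // hn; case: gX => _ _; rewrite path_sortedE; last exact: ltn_trans.
by case/andP=> /allP /(_ _ hn); rewrite -nth0 e /= ltnn.
Qed.

(** Slides only permute the cells: on contents, promotion reads n as 0 and adds 1. *)
Lemma count_mem_rotate n w W : 0 < n -> in_range n w ->
  perm_eq W [seq if x == n then 0 else x | x <- w] ->
  (forall x, 0 < x < n -> count_mem x.+1 (map S W) = count_mem x w) /\
  count_mem 1 (map S W) = count_mem n w.
Proof.
move=> n0 hw /permP hW.
have cS v : count_mem v.+1 (map S W) = count_mem v W.
  by rewrite count_map; apply: eq_count.
split=> [x hx|]; rewrite cS hW count_map.
  by apply: eq_count => y /=; case: (eqVneq y n); lia.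
by apply: eq_in_count => y /(allP hw) /=; case: (eqVneq y n); lia.
Qed.

Lemma filter_iota_last (p : pred nat) n : 0 < n ->
  filter p (iota 1 n) = filter p (iota 1 n.-1) ++ (if p n then [:: n] else [::]).
Proof.
case: n => // n _; have -> : iota 1 n.+1 = iota 1 n ++ [:: n.+1].
  by rewrite -[n.+1 in LHS]addn1 iotaD.
by rewrite filter_cat.
Qed.

Lemma filter_iota_rotate (p q : pred nat) n : 0 < n ->
  (forall x, 0 < x < n -> q x.+1 = p x) -> q 1 = p n ->
  filter q (iota 1 n) =
  (if p n then [:: 1] else [::]) ++ map S (filter p (iota 1 n.-1)).
Proof.
case: n => // n _ hq h1 /=; rewrite h1.
have -> : iota 2 n = map S (iota 1 n) by rewrite -(iotaDl 1 1).
rewrite filter_map (eq_in_filter (a2 := p)); first by case: ifP.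
by move=> x; rewrite mem_iota => hx /=; apply: hq; lia.
Qed.

Lemma put_dots_lt n s : all (fun x => x < n) s ->
  [seq if x == n then 0 else x | x <- s] = s.
Proof. by elim: s => //= x s IH /andP[hx /IH ->]; rewrite ltn_eqF. Qed.

Lemma put_dots_nseq n k :
  [seq if x == n then 0 else x | x <- nseq k n] = nseq k 0.
Proof. by rewrite map_nseq eqxx. Qed.

(** A dot in the leg comes first: it pushes the first column down, so that the corner entry [a]
    enters the leg, and takes the corner itself; the dots of the row then line up behind it. Without
    such a dot only the row moves. *)
Lemma hook_slide_dots n X : 0 < n -> hook_good n X ->
  let k := count_mem n X.1 in let D := filter (fun x => x < n) X.1 in
  [/\ X.1 = D ++ nseq k n, all (fun x => x < n) D
    & if n \in X.2 then exists a D' L,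
         [/\ D = a :: D', X.2 = rcons L n, all (fun x => x < n) L &
         slide_dots n (hook_tab X) = hook_tab (nseq k.+1 0 ++ D', a :: L)]
      else slide_dots n (hook_tab X) = hook_tab (nseq k 0 ++ D, X.2)].
Proof.
move=> n0 gX k D.
have hX : X.1 = D ++ nseq k n.
  case: gX => _ o _ r _; rewrite {1}(filter_letter_sorted n o) -/D -/k.
  rewrite (_ : count_mem n.+1 X.1 = 0) ?cats0; last first.
    by apply/count_memPn/negP => /(allP r); lia.
  rewrite (eq_in_filter (a2 := pred0)) ?filter_pred0 ?cats0 //.
  by move=> x /(allP r) /=; lia.
have hD : all (fun x => x < n) D by exact: filter_all.
have D0 : all (ltn 0) D.
  by apply/allP => x; rewrite mem_filter => /andP[_]; case: gX => _ _ _ /allP h _ /h /andP[].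
have nD : n \notin D by apply/negP => /(allP hD); rewrite ltnn.
split=> //; rewrite /slide_dots (hook_dot_cells n0 gX hX nD).
have pd L : all (fun x => x < n) L -> map (map (fun x => if x == n then 0 else x)) [seq [:: x] | x <- L] = [seq [:: x] | x <- L].
  by elim: L => //= x L IH /andP[hx /IH ->]; rewrite ltn_eqF.
case hn: (n \in X.2); last first.
  rewrite /put_dots /= {1}hX map_cat put_dots_lt // put_dots_nseq pd.
    exact: (slide_dots_row0 0 k [seq [:: x] | x <- X.2] D0).
  case: gX => _ _ _ _ r2; apply/allP => x hx.
  have := allP r2 _ hx; have : x != n by apply: contraFneq hn => <-.
  lia.
(* Were [D] empty, the corner would be n and the leg below it could not contain n. *)
have [a [D' eD]] : exists a D', D = a :: D'.
  case: (D) hX => [|a D'] hX; last by exists a, D'.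
  case: gX; rewrite hX; case: (k) => // k' _ _ /=.
  rewrite path_sortedE; last exact: ltn_trans.
  by case/andP=> /allP /(_ _ hn); rewrite /= ltnn.
have [L eL hL] : exists2 L, X.2 = rcons L n & all (fun x => x < n) L.
  case: gX => _ _ /path_sorted o _ r2; apply: sorted_ltn_max => //.
  by apply: sub_all r2 => x /andP[].
exists a, D', L; split=> //; rewrite foldl_cat.
rewrite -[foldl _ _ [:: _]]/(slide_dot (size X.2 + 0) _ (size X.2) 0).
have -> : put_dots n (hook_tab X) =
    cons_col ((a :: L) ++ [:: 0]) [:: D' ++ nseq k 0].
  rewrite /put_dots /= hX map_cat put_dots_lt // put_dots_nseq eD /=.
  congr cons; rewrite eL -cats1 !map_cat pd //= eqxx.
  by elim: (L) => //= x L' ->.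
have -> : size X.2 + 0 = size (a :: L) by rewrite eL size_rcons addn0.
have -> : size X.2 = size (a :: L) by rewrite eL size_rcons.
rewrite slide_dot_col0; last first.
  move: D0; rewrite eD /= => /andP[-> _] /=; apply/allP => x hx.
  by case: gX => _ _ _ _ /allP /(_ x); rewrite eL mem_rcons inE hx orbT => /(_ isT) /andP[].
(* The tableau is now viewed as a row above a leg; the dot in the corner is the one already arrived,
   hence [nseq 1 0]. *)
have -> : cons_col (0 :: (a :: L) ++ [::]) [:: D' ++ nseq k 0] =
    (nseq 1 0 ++ D' ++ nseq k 0) :: [seq [:: x] | x <- a :: L].
  rewrite cats0 /=; congr (_ :: _ :: _).
  by elim: (L) => //= x L' ->.
have D'0 : all (ltn 0) D' by move: D0; rewrite eD => /andP[].
by rewrite eD -[size (a :: D')]/(1 + size D') slide_dots_row0.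
Qed.

Lemma sorted_nseq_cat k D : all (ltn 0) D -> sorted leq D ->
  sorted leq (nseq k 0 ++ D).
Proof.
move=> h0 hD; elim: k => //= k IH; rewrite path_sortedE ?IH ?andbT; last exact: leq_trans.
by apply/allP.
Qed.

(** When n occurs, the new least entry is 1, and the old least entry, in the corner, becomes
    recorded in first position. It lies in the leg exactly when n did, so the last bit moves to the
    front, which is [rotr 1]. *)
Lemma hook_promotion n X : 0 < n -> hook_good n X -> exists Y,
  [/\ hook_good n Y, promotion n (hook_tab X) = hook_tab Y,
      forall x, 0 < x < n -> mult Y x.+1 = mult X x, mult Y 1 = mult X n
    & hook_code n Y =
      if 0 < mult X n then rotr 1 (hook_code n X) else hook_code n X].
Proof.
move=> n0 gX; have [hX hD] := hook_slide_dots n0 gX.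
set k := count_mem n X.1 in hX *; set D := filter _ _ in hX hD *.
have tabS Y : map (map S) (hook_tab Y) = hook_tab (map S Y.1, map S Y.2).
  by rewrite /hook_tab /= -!map_comp.
have rw : in_range n (X.1 ++ X.2) by case: gX => *; rewrite /in_range all_cat; apply/andP.
have [h0 o1 o2 r1 r2] := gX.
have oD : sorted leq D by apply: sorted_filter => //; exact: leq_trans.
have D0 : all (ltn 0) D.
  by apply/allP => x; rewrite mem_filter => /andP[_] /(allP r1) /andP[].
have SK : injective S by move=> ? ? [].
have l0 : all (ltn 0) X.2 by apply: sub_all r2 => x /andP[].
have rS s : all (fun x => x < n) s -> in_range n (map S s).
  by move=> h; rewrite /in_range all_map; apply: sub_all h.
(* Comparison of the words, common to both cases: the corner entry takes the side of n, and the
   other entries below n keep theirs. *)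
have code Y : hook_good n Y -> 
    (forall x, 0 < x < n -> mult Y x.+1 = mult X x) ->
    mult Y 1 = mult X n ->
    (forall x, 0 < x < n -> x != head 0 X.1 -> (x.+1 \in Y.2) = (x \in X.2)) ->
    (0 < mult X n -> ((head 0 X.1).+1 \in Y.2) = (n \in X.2)) ->
    hook_code n Y =
      if 0 < mult X n then rotr 1 (hook_code n X) else hook_code n X.
  move=> gY m1 m2 hY ha; rewrite /hook_code.
  have := hook_support_head gX.
  rewrite /hook_support (filter_iota_last _ n0).
  rewrite (@filter_iota_rotate (fun x => 0 < mult X x) (fun x => 0 < mult Y x) n) //; last 2 first.
  - by move=> x hx; rewrite m1.
  - by rewrite m2.
  set s0 := filter _ (iota 1 n.-1).
  have s0r x : x \in s0 -> 0 < x < n by rewrite mem_filter mem_iota; clear; lia.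
  have : uniq s0 by rewrite filter_uniq ?iota_uniq.
  case: ifP => hn /=; last first.
    rewrite cats0 => us0 es0; rewrite behead_map -map_comp; apply/eq_in_map => x hx /=.
    rewrite hY //; first by apply: s0r; rewrite es0 inE hx orbT.
    by apply: contraTneq us0 => ex; rewrite es0 /= -ex hx.
  case: (s0) s0r => //= a s s0r /andP[ua us] [ea].
  rewrite ea ha // cats1 map_rcons rotr1_rcons; congr cons.
  rewrite -map_comp; apply/eq_in_map => x hx /=.
  rewrite hY //; first by apply: s0r; rewrite inE hx orbT.
  by rewrite -ea; apply: contraNneq ua => <-.
rewrite /promotion; case: ifP => hn; last first.
  have l1 : all (fun x => x < n) X.2.
    apply/allP => x hx; have := allP r2 _ hx.
    have : x != n by apply: contraFneq hn => <-.
    by clear; lia.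
  move=> ->; rewrite tabS /=; set Y := (_, _).
  have [m1 m2] : (forall x, 0 < x < n -> mult Y x.+1 = mult X x) /\
      mult Y 1 = mult X n.
    rewrite /mult /= -map_cat; apply: count_mem_rotate => //.
    rewrite hX !map_cat put_dots_lt // put_dots_nseq put_dots_lt.
      by rewrite perm_cat2r perm_catC.
    exact: l1.
  have gY : hook_good n Y.
    split=> /=.
    - by move: h0; rewrite hX size_map !size_cat !size_nseq addnC.
    - rewrite sorted_map; exact: sorted_nseq_cat.
    - rewrite path_sortedE; last exact: ltn_trans.
      rewrite sorted_map (path_sorted o2) andbT all_map.
      move: o2; rewrite path_sortedE; last exact: ltn_trans.
      case/andP=> o2 _; apply/allP => x hx /=.
      have := allP o2 _ hx; have := allP l0 _ hx; rewrite /= hX.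
      by case: (k) => [|k'] //=; case: (D).
    - rewrite map_cat /in_range all_cat; apply/andP; split; last exact: rS.
      by rewrite map_nseq all_nseq n0 orbT.
    - by apply: rS; exact: l1.
  exists Y; split=> //; apply: code => //=.
    by move=> x _ _; rewrite mem_map.
  move=> _; rewrite mem_map // hn; apply/negP => hx.
  move: o2; rewrite path_sortedE; last exact: ltn_trans.
  by case/andP=> /allP /(_ _ hx); rewrite /= ltnn.
move=> [a [D' [L [eD eL hL ->]]]]; rewrite tabS; set Y := (_, _).
have ea : head 0 X.1 = a by rewrite hX eD.
have [m1 m2] : (forall x, 0 < x < n -> mult Y x.+1 = mult X x) /\
    mult Y 1 = mult X n.
  rewrite /mult -map_cat; apply: count_mem_rotate => //.
  rewrite hX eL -cats1 !map_cat put_dots_lt // put_dots_nseq put_dots_lt //= eqxx eD /=.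
  by apply/permP => p; rewrite /= !count_cat /=; clear; lia.
have D'0 : all (ltn 0) D' by move: D0; rewrite eD => /andP[].
have hD' : all (fun x => x < n) D' by move: hD; rewrite eD => /andP[].
have a0 : 0 < a by move: D0; rewrite eD => /andP[].
have an : a < n by move: hD; rewrite eD => /andP[].
have gY : hook_good n Y.
  split=> //=.
  - have := sorted_nseq_cat k.+1 D'0; rewrite /= path_map; apply.
    by move: oD; rewrite eD; exact: path_sorted.
  - rewrite ltnS a0 path_map.
    by move: o2; rewrite ea eL -cats1 cat_path => /andP[].
  - rewrite map_cat /in_range all_cat n0 /=; apply/andP; split; last exact: rS.
    by rewrite map_nseq all_nseq n0 orbT.
  - by rewrite an; exact: rS.
exists Y; split=> //; apply: code => //.
  move=> x hx; rewrite ea eL mem_rcons !inE /= eqSS => /negPf->.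
  by rewrite mem_map //= ltn_eqF //; case/andP: hx.
by rewrite ea hn inE eqxx.
Qed.

(** * Reflections of hooks *)

Lemma sorted_swp i (leT : rel nat) s : leT =2 leq \/ leT =2 ltn ->
  ~~ ((i \in s) && (i.+1 \in s)) -> sorted leT s -> sorted leT (map (swp i) s).
Proof.
move=> hT hs; apply: (homo_sorted_in (P := mem s)); last exact/allP.
move=> x y hx hy hxy.
have : ~~ ((x == i) && (y == i.+1)).
  by apply: contra hs => /andP[/eqP <- /eqP <-]; rewrite [x \in s]hx [y \in s]hy.
case: hT hxy => hT; rewrite !hT /= /swp;
  case: (eqVneq x i); case: (eqVneq y i); case: (eqVneq x i.+1);
  case: (eqVneq y i.+1); lia.
Qed.

Lemma count_mem_swp i x s : count_mem x (map (swp i) s) = count_mem (swp i x) s.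
Proof.
rewrite count_map; apply: eq_count => y /=.
by rewrite -{1}(swpK i x) (inj_eq (@swp_inj i)).
Qed.

Lemma reading_word_hook X : reading_word (hook_tab X) = rev X.2 ++ X.1.
Proof.
rewrite /reading_word /hook_tab rev_cons flatten_rcons -map_rev.
by rewrite flatten_seq1.
Qed.

Lemma filter_letter_strict i s : sorted ltn s ->
  filter (letter i) s = nseq (i \in s) i ++ nseq (i.+1 \in s) i.+1.
Proof.
move=> hs; apply: (irr_sorted_eq ltn_trans ltnn).
- by apply: sorted_filter => //; exact: ltn_trans.
- by case: (i \in s); case: (i.+1 \in s); rewrite //= ltnSn.
move=> x; rewrite mem_filter mem_cat !mem_nseq /letter.
have [->|_] := eqVneq x i; first by case: (i \in s); rewrite //= ltn_eqF // andbF.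
by have [->|_] := eqVneq x i.+1; case: (i.+1 \in s); rewrite //= !andbF.
Qed.

Lemma filter_letter_row i s : sorted leq s ->
  filter (letter i) s = nseq (count_mem i s) i ++ nseq (count_mem i.+1 s) i.+1.
Proof.
move=> hs; rewrite {1}(filter_letter_sorted i hs) !filter_cat -!filter_predI.
rewrite (eq_filter (a2 := pred0)); last by move=> x; rewrite /= /letter; lia.
rewrite [X in _ ++ _ ++ X](eq_filter (a2 := pred0)); last by move=> x; rewrite /= /letter; lia.
rewrite !filter_pred0 cats0 /=; congr cat; apply/all_filterP;
  by rewrite all_nseq /letter eqxx ?orbT.
Qed.

(** [li] and [lj] tell whether [i] and [i.+1] lie in the leg, which is read before the row. An
    [i.+1] of the leg is matched with the next [i]; an [i] alone in the leg is the first unmatched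
    letter and stays [i] because some [i.+1] follows. The hypotheses make the truncated subtractions
    exact. *)
Lemma reflect_word_hook_core i (li lj : bool) a b :
  (li ==> (lj || (0 < b))) -> (lj ==> (li || (0 < a))) ->
  reflect_word i ((nseq lj i.+1 ++ nseq li i) ++ (nseq a i ++ nseq b i.+1)) =
  (nseq lj i.+1 ++ nseq li i) ++
  (nseq (b + lj - li) i ++ nseq (a + li - lj) i.+1).
Proof.
case: li; case: lj => //= h1 h2.
- by rewrite reflect_pair_close_open !addnK.
- have := reflect_close_open i a.+1 b; rewrite /= => ->.
  by case: b h1 => // b _ /=; rewrite addn0 addn1 subn0 subn1.
- case: a h2 => // a _ /=; rewrite reflect_pair_close_open.
  by rewrite !addn0 addn1 subn0 subn1.
- by rewrite !addn0 !subn0 reflect_close_open.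
Qed.

Lemma hook_crystal_refl n i X : 0 < i < n -> hook_good n X -> exists Y,
  [/\ hook_good n Y, crystal_refl i (hook_tab X) = hook_tab Y,
      forall x, 0 < x <= n -> mult Y x = mult X (swp i x)
    & hook_code n Y = hook_code n X].
Proof.
move=> hi gX; have [h0 o1 o2 r1 r2] := gX.
have rswp s : in_range n s -> in_range n (map (swp i) s).
  move=> /allP h; apply/allP => y /mapP[x /h hx ->]; rewrite /swp.
  by move: hi hx; clear; do 2?case: eqP; lia.
case: (boolP ((0 < mult X i) && (0 < mult X i.+1))) => hb; last first.
  have hb' : ~~ ((i \in X.1 ++ X.2) && (i.+1 \in X.1 ++ X.2)).
    by rewrite !mem_cat -!mult_gt0.
  have sub s : {subset s <= X.1 ++ X.2} -> ~~ ((i \in s) && (i.+1 \in s)).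
    by move=> h; apply: contra hb' => /andP[/h -> /h ->].
  have hmu x : mult (map (swp i) X.1, map (swp i) X.2) x = mult X (swp i x).
    by rewrite /mult /= -map_cat count_mem_swp.
  have hh : head 0 X.1 \in X.1 by case: (X.1) h0 => //= *; exact: mem_head.
  exists (map (swp i) X.1, map (swp i) X.2); split=> //.
  - split=> /=; rewrite ?size_map ?rswp //.
      apply: sorted_swp => //; first by left.
      by apply: sub => x hx; rewrite mem_cat hx.
    have := @sorted_swp i ltn (head 0 X.1 :: X.2); rewrite /=.
    have -> : head 0 (map (swp i) X.1) = swp i (head 0 X.1) by case: (X.1) h0.
    apply=> //; first by right.
    by apply: sub => x; rewrite inE mem_cat => /orP[/eqP->|->]; rewrite ?hh ?orbT.
  - apply: crystal_refl_eq; rewrite ?reading_word_hook.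
      by rewrite /shape_of /= size_map -!map_comp.
    rewrite reflect_word_swp ?map_cat ?map_rev //.
    by apply: sub => x; rewrite !mem_cat mem_rev orbC.
  rewrite /hook_code /hook_support (eq_filter (a2 := fun x => 0 < mult X (swp i x))).
    rewrite (@filter_swp_iota i n (fun x => 0 < mult X x)) //.
    rewrite behead_map -map_comp; apply: eq_map => x /=.
    by rewrite mem_map //; exact: swp_inj.
  by move=> x; rewrite hmu.
have ol := path_sorted o2.
have ul : uniq X.2 by apply: sorted_uniq ol; [exact: ltn_trans|exact: ltnn].
pose a := count_mem i X.1; pose b := count_mem i.+1 X.1.
pose li := i \in X.2; pose lj := i.+1 \in X.2.
have mi : mult X i = a + li by rewrite /mult count_cat (count_uniq_mem _ ul).
have mj : mult X i.+1 = b + lj by rewrite /mult count_cat (count_uniq_mem _ ul).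
pose u := filter (fun x => x < i) X.1; pose v := filter (fun x => i.+1 < x) X.1.
(* New multiplicities in the row, forced by exchanging the totals while the leg is fixed; no
   truncation occurs, since both totals are positive. *)
pose a' := b + lj - li; pose b' := a + li - lj.
pose row := u ++ (nseq a' i ++ nseq b' i.+1) ++ v.
have eX : X.1 = u ++ (nseq a i ++ nseq b i.+1) ++ v := filter_letter_sorted i o1.
have [hb1 hb2] : 0 < a + li /\ 0 < b + lj by rewrite -mi -mj; apply/andP.
have [ea eb] : a' + li = b + lj /\ b' + lj = a + li.
  by move: hb1 hb2; rewrite /a' /b'; move: (a) (b) (li) (lj); clear => c d [] []; lia.
have hu x : x \in u -> (x < i) /\ (x \in X.1) by rewrite mem_filter => /andP.
have hv x : x \in v -> (i.+1 < x) /\ (x \in X.1) by rewrite mem_filter => /andP.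
have hmu x : mult (row, X.2) x = mult X (swp i x).
  have [->|n1] := eqVneq x i.
    rewrite swpl mj /mult !count_cat !count_nseq (count_uniq_mem _ ul) -/li /= eqxx.
    rewrite [i.+1 == i]gtn_eqF // !(count_memPn _); first by rewrite -ea /= mul1n mul0n !addn0.
      by apply/negP => /hv []; clear; lia.
    by apply/negP => /hu []; clear; lia.
  have [->|n2] := eqVneq x i.+1.
    rewrite swpr mi /mult !count_cat !count_nseq (count_uniq_mem _ ul) -/lj /= eqxx.
    rewrite [i == i.+1]ltn_eqF // !(count_memPn _); first by rewrite -eb /= mul1n mul0n addn0.
      by apply/negP => /hv []; clear; lia.
    by apply/negP => /hu []; clear; lia.
  rewrite swp_id; last by rewrite /letter negb_or n1.
  rewrite /mult [in RHS]eX !count_cat !count_nseq /=.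
  by rewrite [i == x]eq_sym (negPf n1) [i.+1 == x]eq_sym (negPf n2).
have sab : a' + b' = a + b.
  by move: ea eb; move: (a') (b') (a) (b) (li) (lj); clear=> p q r s [] []; lia.
have size_row : size row = size X.1.
  by rewrite eX /row !size_cat !size_nseq sab.
exists (row, X.2); split=> //.
- split=> //=.
  + by rewrite size_row.
  + apply: sorted_letter_blocks; rewrite ?filter_all ?sorted_filter //; exact: leq_trans.
  + rewrite path_sortedE ?ol ?andbT; last exact: ltn_trans.
    move: o2; rewrite path_sortedE; last exact: ltn_trans.
    case/andP=> /allP o2 _; apply/allP => x hx; have := o2 _ hx.
    have hh : head 0 X.1 \in X.1 by case: (X.1) h0 => //= *; exact: mem_head.
    (* An entry below [i] stays in the corner. Otherwise the old corner is at least [i], hence [i]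
       is not in the leg and [a'] is positive: the new corner is [i], not larger than the old
       one. *)
    rewrite /row; case eu: u => [|y u']; last by rewrite eX eu.
    have hge : i <= head 0 X.1.
      rewrite leqNgt; apply/negP => hlt.
      by have : head 0 X.1 \in u; [rewrite mem_filter hh hlt|rewrite eu].
    have nli : li = false.
      by apply/negP => /o2 /=; move: hge; clear; lia.
    have : 0 < a' by move: ea hb2; rewrite nli; clear; lia.
    by case: (a') => //= _ _; exact: leq_ltn_trans.
  + apply/allP => x; rewrite !mem_cat !mem_nseq => /orP[/hu[_ /(allP r1)//]|].
    case/orP; last by move=> /hv[_ /(allP r1)].
    by move: hi; clear; lia.
- apply: crystal_refl_eq; rewrite ?reading_word_hook /=.
    by rewrite /shape_of /= size_row.
  rewrite reflect_wordE filter_cat filter_rev filter_letter_strict //.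
  rewrite filter_letter_row // rev_cat !rev_nseq -/li -/lj -/a -/b.
  rewrite reflect_word_hook_core; last 2 first.
  + by move: hb2; move: (b) (li) (lj); clear => d [] []; lia.
  + by move: hb1; move: (a) (li) (lj); clear => d [] []; lia.
  have er : nseq lj i.+1 ++ nseq li i = filter (letter i) (rev X.2).
    by rewrite filter_rev filter_letter_strict // rev_cat !rev_nseq.
  rewrite er refill_cat // refill_id; congr cat.
  have nu : filter (letter i) u = [::].
    rewrite (eq_in_filter (a2 := pred0)) ?filter_pred0 // => x /hu.
    by case=> h _; move: h; rewrite /letter /=; clear; lia.
  have nv : filter (letter i) v = [::].
    rewrite (eq_in_filter (a2 := pred0)) ?filter_pred0 // => x /hv.
    by case=> h _; move: h; rewrite /letter /=; clear; lia.
  have hl c d : all (letter i) (nseq c i ++ nseq d i.+1).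
    by rewrite all_cat !all_nseq /letter !eqxx !orbT.
  rewrite eX -[nseq (_ - _) _ ++ _]cat0s refill_cat ?nu // refill_neutral //.
  rewrite /row -[nseq (_ - _) _ ++ _]cats0 refill_cat; last first.
    by rewrite (all_filterP (hl _ _)) !size_cat !size_nseq.
  rewrite [refill i v _]refill_neutral // refill_letters ?hl ?cats0 //.
    by rewrite !size_cat !size_nseq.
rewrite /hook_code (_ : hook_support n (row, X.2) = hook_support n X) //.
apply: eq_filter => x; rewrite hmu.
have [->|n1] := eqVneq x i; first by rewrite swpl mi mj hb1 hb2.
have [->|n2] := eqVneq x i.+1; first by rewrite swpr mi mj hb1 hb2.
by rewrite swp_id // /letter negb_or n1.
Qed.

Lemma hook_iter_promotion n la : 0 < n -> hook_shape la ->
  (forall i : nat, 1 <= i <= n - 1 ->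
     {in SST n la, crystal_refl i \o iter n (promotion n)
                   =1 iter n (promotion n) \o crystal_refl i})
  /\ {in SST n la, coxeter n \o iter n (promotion n)
                   =1 iter n (promotion n) \o coxeter n}.
Proof.
move=> n0 hla; have inj := @hook_encoding_inj n.
have pr X (gX : hook_good n X) := hook_promotion n0 gX.
have rf i X (hi : 0 < i < n) (gX : hook_good n X) := hook_crystal_refl hi gX.
split=> [i hi|] T /(SST_hook hla) [X gX ->] /=.
  have hi' : 0 < i < n by move: hi; clear; lia.
  exact: (crystal_refl_iter_promotion inj pr rf hi' gX).
exact: (coxeter_iter_promotion inj pr rf).
Qed.

(** * Two columns *)

(** Polymorphic, so that entries can be tagged with their column. *)
Definition two_tab (X : Type) (C1 C2 : seq X) : seq (seq X) :=
  cons_col C1 [seq [:: b] | b <- C2].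

Record two_good (n : nat) (X : seq nat * seq nat) : Prop := TwoGood {
  two_size0 : 0 < size X.2;
  two_size : size X.2 <= size X.1;
  two_sorted1 : sorted ltn X.1;
  two_sorted2 : sorted ltn X.2;
  two_range1 : in_range n X.1;
  two_range2 : in_range n X.2;
  two_rows : forall j, j < size X.2 -> nth 0 X.1 j <= nth 0 X.2 j }.

Definition two_singles (n : nat) (X : seq nat * seq nat) : seq nat :=
  [seq x <- iota 1 n | mult X x == 1].

Definition two_code (n : nat) (X : seq nat * seq nat) : seq bool :=
  [seq x \in X.1 | x <- two_singles n X].

Lemma two_uniq1 n X : two_good n X -> uniq X.1.
Proof. by case=> *; apply: (sorted_uniq ltn_trans ltnn). Qed.

Lemma two_uniq2 n X : two_good n X -> uniq X.2.
Proof. by case=> *; apply: (sorted_uniq ltn_trans ltnn). Qed.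

Lemma two_mult n X x : two_good n X -> mult X x = (x \in X.1) + (x \in X.2).
Proof.
move=> gX; rewrite /mult count_cat.
by rewrite (count_uniq_mem _ (two_uniq1 gX)) (count_uniq_mem _ (two_uniq2 gX)).
Qed.

(** Row lengths decrease, so the rows of length 2 come first and their second entries form a column
    without gaps. *)
Lemma two_tab_rows T : sorted geq (shape_of T) ->
  all (fun k => 0 < k <= 2) (shape_of T) ->
  T = two_tab (map (head 0) T) [seq nth 0 r 1 | r <- T & size r == 2].
Proof.
elim: T => // r T IH /= hs /andP[hr hT].
have {}IH := IH (path_sorted hs) hT.
case: r hr hs => // x [|y [|//]] _ /= hs; last by rewrite /two_tab /= {1}IH.
suff hf : [seq r <- T | size r == 2] = [::] by rewrite /two_tab /= hf {1}IH hf.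
rewrite (eq_in_filter (a2 := pred0)) ?filter_pred0 // => r hrT /=.
move: hs; rewrite path_sortedE; last by move=> a b c /= h1 h2; exact: leq_trans h2 h1.
by case/andP=> /allP /(_ (size r) (map_f _ hrT)) /=; case: (size r) => [|[]].
Qed.

Lemma SST_two n la T : is_part la -> two_column_shape la -> T \in SST n la ->
  exists2 X, two_good n X & T = two_tab X.1 X.2.
Proof.
move=> /andP[hs h0] hla; rewrite unfold_in => /and4P[/eqP hsh hr hrow hcol].
have h2 : all (fun k => 0 < k <= 2) (shape_of T).
  rewrite hsh; case: la hla hs h0 {hsh} => // k la; rewrite /two_column_shape /= => -> hp h0.
  apply/allP => k' hk.
  move: hp; rewrite path_sortedE; last by move=> a b c /= e1 e2; exact: leq_trans e2 e1.
  by case/andP=> /allP /(_ _ hk) /= -> _; have /= -> := allP h0 _ hk.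
have := two_tab_rows _ h2; rewrite hsh => /(_ hs).
set C1 := map _ T; set C2 := map _ (filter _ _) => eT.
have sz : size C2 <= size C1 by rewrite !size_map size_filter count_size.
have sT : size T = size C1 by rewrite size_map.
have e1 j : j < size C2 -> nth [::] T j = [:: nth 0 C1 j; nth 0 C2 j].
  move=> hj; rewrite eT (nth_cons_col 0); last exact: leq_trans hj sz.
  by rewrite (nth_map 0).
have e2 j : j < size C1 -> nth [::] T j = nth 0 C1 j :: behead (nth [::] T j).
  by move=> hj; rewrite eT (nth_cons_col 0).
exists (C1, C2) => //; split=> //=.
- rewrite size_map size_filter -has_count; move: hla.
  by rewrite /two_column_shape -hsh; case: (T) => //= r T' ->.
- apply/(sortedP 0) => j hj; move/(sortedP [::])/(_ j): hcol; rewrite sT => /(_ hj).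
  by rewrite (e2 j (ltnW hj)) (e2 j.+1 hj) => /andP[].
- apply/(sortedP 0) => j hj; move/(sortedP [::])/(_ j): hcol; rewrite sT.
  move=> /(_ (leq_trans hj sz)); rewrite !e1 //=; last exact: ltnW.
  by case/and3P.
- apply/(all_nthP 0) => j hj; move/(all_nthP [::])/(_ j): hr; rewrite sT => /(_ hj).
  by rewrite e2 //= => /andP[].
- apply/(all_nthP 0) => j hj; move/(all_nthP [::])/(_ j): hr.
  rewrite sT => /(_ (leq_trans hj sz)).
  by rewrite e1 //= => /and3P[].
- move=> j hj; move/(all_nthP [::])/(_ j): hrow.
  by rewrite sT => /(_ (leq_trans hj sz)); rewrite e1 //= andbT.
Qed.

(** Multiplicities 0 and 2 leave no choice of column; for multiplicity 1 the word decides. *)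
Lemma two_encoding_inj n X Y : two_good n X -> two_good n Y ->
  (forall x, 0 < x <= n -> mult X x = mult Y x) ->
  two_code n X = two_code n Y -> X = Y.
Proof.
move=> gX gY hmu hc.
have hsup : two_singles n X = two_singles n Y.
  by apply: eq_in_filter => x; rewrite mem_iota => hx; rewrite hmu //; lia.
move: hc; rewrite /two_code hsup => /eq_in_map hc.
have h1 x : 0 < x <= n -> (x \in X.1) = (x \in Y.1).
  move=> hx; have := hmu x hx; rewrite (two_mult _ gX) (two_mult _ gY).
  case: (eqVneq (mult Y x) 1) => hy.
    by rewrite hc // mem_filter hy eqxx mem_iota; lia.
  move: hy; rewrite (two_mult _ gY).
  by case: (x \in X.1); case: (x \in X.2); case: (x \in Y.1); case: (x \in Y.2).
have h2 x : 0 < x <= n -> (x \in X.2) = (x \in Y.2).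
  move=> hx; have := hmu x hx; rewrite (two_mult _ gX) (two_mult _ gY) h1 // => /addnI.
  by case: (x \in X.2); case: (x \in Y.2).
have hout (Z : seq nat) x : in_range n Z -> ~~ (0 < x <= n) -> (x \in Z) = false.
  by move=> /allP hZ; apply: contraNF => /hZ.
have e1 : X.1 = Y.1.
  apply: (irr_sorted_eq ltn_trans ltnn); [by case: gX|by case: gY|].
  move=> x; case: (boolP (0 < x <= n)) => hx; first exact: h1.
  by rewrite !hout //; [case: gY|case: gX].
have e2 : X.2 = Y.2.
  apply: (irr_sorted_eq ltn_trans ltnn); [by case: gX|by case: gY|].
  move=> x; case: (boolP (0 < x <= n)) => hx; first exact: h2.
  by rewrite !hout //; [case: gY|case: gX].
by case: X Y e1 e2 {gX gY hmu hc hsup h1 h2} => [? ?] [? ?] /= -> ->.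
Qed.

(** * Slides starting in the second column *)

Lemma entry_two1 (C1 C2 : seq nat) r : size C2 <= size C1 ->
  entry (two_tab C1 C2) r 1 = nth 0 C2 r.
Proof.
move=> hs; case: (ltnP r (size C1)) => hr.
  rewrite entry_cons_colS //; case: (ltnP r (size C2)) => hr2.
    by rewrite (nth_map 0).
  by rewrite (nth_default [::]) ?size_map // [RHS]nth_default.
rewrite /entry (nth_default [::]) ?size_cons_col // [RHS]nth_default //.
exact: leq_trans hr.
Qed.

Lemma set_entry_two1 (C1 C2 : seq nat) r x : size C2 <= size C1 -> r < size C2 ->
  set_entry (two_tab C1 C2) r 1 x = two_tab C1 (set_nth 0 C2 r x).
Proof.
move=> hs hr; rewrite set_entry_cons_colS; last exact: leq_trans hs.
rewrite /two_tab; congr cons_col; rewrite (nth_map 0) //=.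
by elim: C2 r hr {hs} => //= b C2 IH [|r] //= /IH ->.
Qed.

(** The last hypothesis compares the two neighbours of the dot in row [(size B1 + j).+1]. Ties go
    up, so the weak inequality keeps the dot in its column all along [B2]; [k] moves remain
    afterwards. *)
Lemma slide_dot_col1 k (C1 B1 B2 E : seq nat) :
  size (B1 ++ B2 ++ 0 :: E) <= size C1 -> all (ltn 0) B2 ->
  (forall j, j < size B2 -> nth 0 C1 (size B1 + j).+1 <= nth 0 B2 j) ->
  slide_dot (k + size B2) (two_tab C1 (B1 ++ B2 ++ 0 :: E)) (size B1 + size B2) 1 =
  slide_dot k (two_tab C1 (B1 ++ 0 :: B2 ++ E)) (size B1) 1.
Proof.
elim/last_ind: B2 E => [|B2 x IH] E; first by rewrite !addn0.
rewrite size_rcons all_rcons !addnS => hs /andP[x0 hB] hrow.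
have {}hs : size B1 + size B2 + 2 + size E <= size C1.
  by move: hs; rewrite !size_cat size_rcons /=; lia.
rewrite [LHS]/= entry_two1 ?entry_cons_col0; last first.
  by rewrite !size_cat size_rcons /=; lia.
have -> : nth 0 (B1 ++ rcons B2 x ++ 0 :: E) (size B1 + size B2) = x.
  by rewrite cat_rcons catA nth_cat size_cat ltnn subnn.
rewrite gtn_eqF // andFb.
have := hrow (size B2); rewrite nth_rcons ltnn eqxx => -> //.
rewrite set_entry_two1; last 2 first.
- by rewrite !size_cat size_rcons /=; lia.
- by rewrite !size_cat size_rcons /=; lia.
have -> : set_nth 0 (B1 ++ rcons B2 x ++ 0 :: E) (size B1 + size B2).+1 x =
    (B1 ++ B2) ++ x :: x :: E.
  have -> : (size B1 + size B2).+1 = size (B1 ++ rcons B2 x).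
    by rewrite size_cat size_rcons addnS.
  by rewrite catA set_nth_cat_size -!catA cat_rcons.
rewrite set_entry_two1; last 2 first.
- by rewrite !size_cat /=; lia.
- by rewrite !size_cat /=; lia.
have -> : set_nth 0 ((B1 ++ B2) ++ x :: x :: E) (size B1 + size B2) 0 =
    B1 ++ B2 ++ 0 :: x :: E by rewrite -size_cat set_nth_cat_size -catA.
rewrite IH ?cat_rcons //.
- by rewrite !size_cat /=; lia.
- by move=> j hj; have := hrow j (ltnW hj); rewrite nth_rcons hj.
Qed.

Lemma two_dot_cells n X k1 k2 D1 D2 : 0 < n -> two_good n X ->
  X.1 = D1 ++ nseq k1 n -> n \notin D1 -> X.2 = D2 ++ nseq k2 n -> n \notin D2 ->
  dot_cells n (two_tab X.1 X.2) =
  [seq (r, 0) | r <- iota (size D1) k1] ++ [seq (r, 1) | r <- iota (size D2) k2].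
Proof.
move=> n0 gX e1 h1 e2 h2.
have [s0 s1] := (two_size0 gX, two_size gX).
rewrite -(filter_index_cat_nseq k1 h1) -(filter_index_cat_nseq k2 h2) -e1 -e2.
rewrite /dot_cells size_cons_col.
have -> : size (head [::] (two_tab X.1 X.2)) = 2.
  by case: (X.1) (X.2) s0 s1 => [|a C1] [|b C2].
rewrite /= cats0 filter_cat !filter_map; congr (_ ++ _); congr [seq _ | r <- _].
  by apply: eq_filter => r /=; rewrite entry_cons_col0.
rewrite (eq_filter (a2 := fun r => nth 0 X.2 r == n)); last first.
  by move=> r /=; rewrite entry_two1.
rewrite -{1}(subnKC s1) iotaD filter_cat add0n [X in _ ++ X](eq_in_filter (a2 := pred0)).
  by rewrite filter_pred0 cats0.
move=> r; rewrite mem_iota => /andP[hr _]; rewrite nth_default //=.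
by apply/eqP; lia.
Qed.

(** * Ballot words and the point where a slide turns left *)

Definition balanced (s : seq bool) : bool := count id s == count negb s.

(** Only proper prefixes are considered, because the letter just after the prefix is the one to be
    changed. For nonempty [g] the empty prefix always qualifies. *)
Definition last_balanced (g : seq bool) : nat :=
  last 0 [seq j <- iota 0 (size g) | balanced (take j g)].

(* [true] stands for a letter of the first column.  A word [g true] becomes
   [true g]; a word [g true h false], with [g] the longest such balanced prefix,
   becomes [true g false h]. *)
Definition ballot_promotion (s : seq bool) : seq bool :=
  let g := take (size s).-1 s in
  true :: if last true s then g else set_nth false g (last_balanced g) false.

Lemma ballot_promotion_rcons g b : ballot_promotion (rcons g b) =
  true :: if b then g else set_nth false g (last_balanced g) false.
Proof. by rewrite /ballot_promotion size_rcons last_rcons -cats1 take_size_cat. Qed.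

Lemma last_filter_iota (P : pred nat) m j : j < m -> P j ->
  (forall k, j < k < m -> ~~ P k) -> last 0 (filter P (iota 0 m)) = j.
Proof.
move=> hj Pj hP; have -> : m = j + (1 + (m - j.+1)) by lia.
rewrite !iotaD !filter_cat !last_cat /= Pj /= add0n.
rewrite (eq_in_filter (a2 := pred0)) ?filter_pred0 // => k.
by rewrite mem_iota => hk; apply/negbTE/hP; lia.
Qed.

(** An entry of [B] below [y] has a left neighbour below [y]: this is the ballot property. *)
Lemma count_lt_rows y (A B : seq nat) : size B <= size A ->
  (forall j, j < size B -> nth 0 A j <= nth 0 B j) ->
  count (fun z => z < y) B <= count (fun z => z < y) A.
Proof.
elim: B A => // b B IH [|a A] //= hs hr.
have := IH A hs (fun j hj => hr j.+1 hj); have := hr 0 isT => /=.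
by case: (ltnP b y); case: (ltnP a y); lia.
Qed.

Lemma take_index_sorted y s : sorted ltn s -> y \in s ->
  take (index y s) s = filter (fun z => z < y) s.
Proof.
elim: s => //= b s IH hp; have hs := path_sorted hp; rewrite inE.
have hb z : z \in s -> b < z.
  by move: hp; rewrite path_sortedE; [case/andP=> /allP h _ /h|exact: ltn_trans].
have [<-|nyb] /= := eqVneq b y.
  rewrite ltnn (eq_in_filter (a2 := pred0)) ?filter_pred0 // => z /hb /=; lia.
by move=> hy; rewrite hb //= IH.
Qed.

Lemma count_add (p q r : pred nat) s :
  (forall z, (p z : nat) = q z + r z) -> count p s = count q s + count r s.
Proof. by move=> h; elim: s => //= z s ->; rewrite h; lia. Qed.

Lemma count_lt_iota n y (C : seq nat) : uniq C -> in_range n C -> y <= n ->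
  count (fun z => z < y) C = count (fun z => (z < y) && (z \in C)) (iota 1 n.-1).
Proof.
move=> uC rC hy; rewrite -!size_filter; apply/perm_size/uniq_perm.
- exact: filter_uniq.
- by rewrite filter_uniq ?iota_uniq.
move=> z; rewrite !mem_filter mem_iota; case: (boolP (z \in C)) => hz; last by rewrite !andbF.
by have := allP rC _ hz; lia.
Qed.

(* Letters occurring twice contribute equally to both sides. *)
Lemma balanced_take n X y : two_good n X ->
  let s0 := [seq x <- iota 1 n.-1 | mult X x == 1] in
  y \in s0 -> balanced (take (index y s0) [seq x \in X.1 | x <- s0]) =
  (count (fun z => z < y) X.1 == count (fun z => z < y) X.2).
Proof.
move=> gX s0 hy.
have hs : sorted ltn s0 by apply: sorted_filter; [exact: ltn_trans|exact: iota_ltn_sorted].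
have yn : y <= n by move: hy; rewrite mem_filter mem_iota; lia.
rewrite -map_take take_index_sorted // /balanced !count_map !count_filter.
rewrite (count_lt_iota (two_uniq1 gX) (two_range1 gX) yn).
rewrite (count_lt_iota (two_uniq2 gX) (two_range2 gX) yn).
pose r z := (z < y) && ((z \in X.1) && (z \in X.2)).
rewrite (@count_add (fun z => (z < y) && (z \in X.1))
  (fun z => ((z \in X.1) && (z < y)) && (mult X z == 1)) r); last first.
  move=> z; rewrite /r (two_mult _ gX).
  by case: (z < y); case: (z \in X.1); case: (z \in X.2).
rewrite (@count_add (fun z => (z < y) && (z \in X.2))
  (fun z => ((z \notin X.1) && (z < y)) && (mult X z == 1)) r); last first.
  move=> z; rewrite /r (two_mult _ gX).
  by case: (z < y); case: (z \in X.1); case: (z \in X.2).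
rewrite eqn_add2r.
by congr (_ == _); apply: eq_count => z /=; rewrite ?andbA.
Qed.

Lemma two_good_shift n V1 V2 : 0 < size V2 -> size V2 <= size V1 ->
  sorted ltn V1 -> sorted ltn V2 -> all (fun x => x < n) V1 ->
  all (fun x => x < n) V2 ->
  (forall j, j < size V2 -> nth 0 V1 j <= nth 0 V2 j) ->
  two_good n (map S V1, map S V2).
Proof.
move=> s0 s1 o1 o2 r1 r2 h; split; rewrite /= ?size_map ?sorted_map //.
- by rewrite /in_range all_map.
- by rewrite /in_range all_map.
by move=> j hj; rewrite !(nth_map 0) ?ltnS ?h //; exact: leq_trans s1.
Qed.

(** [x] is the entry at which a dot climbing from below [B] turns left: the first left neighbour met
    that exceeds the entry above, [last 0 B1]. In the top row the entry above reads 0, so the dot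
    turns there at the latest. *)
Lemma two_slide_split (C1 B : seq nat) : all (ltn 0) C1 -> size B < size C1 ->
  exists A1 x A2 B1 B2, [/\ C1 = A1 ++ x :: A2, B = B1 ++ B2, size A1 = size B1,
    last 0 B1 < x & forall j, j < size B2 -> nth 0 A2 j <= nth 0 B2 j].
Proof.
move=> h0 hs.
suff [B1 [B2 [eB hl hr]]] : exists B1 B2, [/\ B = B1 ++ B2,
    last 0 B1 < nth 0 C1 (size B1) &
    forall j, j < size B2 -> nth 0 C1 (size B1 + j).+1 <= nth 0 B2 j].
  have hB1 : size B1 < size C1 by move: hs; rewrite eB size_cat; lia.
  exists (take (size B1) C1), (nth 0 C1 (size B1)), (drop (size B1).+1 C1), B1, B2.
  split=> //.
  - by rewrite -drop_nth // cat_take_drop.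
  - by rewrite size_take hB1.
  - by move=> j hj; rewrite nth_drop addSn hr.
suff : forall B1 B2, B = B1 ++ B2 ->
    (forall j, j < size B2 -> nth 0 C1 (size B1 + j).+1 <= nth 0 B2 j) ->
    exists B1 B2, [/\ B = B1 ++ B2, last 0 B1 < nth 0 C1 (size B1) &
    forall j, j < size B2 -> nth 0 C1 (size B1 + j).+1 <= nth 0 B2 j].
  by move=> h; apply: (h B [::]); rewrite ?cats0.
elim/last_ind => [|B1 b IH] B2 eB hr.
  exists [::], B2; split=> //=.
  by case: (C1) h0 hs => //= a C /andP[].
have [hb|hb] := ltnP b (nth 0 C1 (size B1).+1).
  by exists (rcons B1 b), B2; split=> //; rewrite last_rcons size_rcons.
apply: (IH (b :: B2)); first by rewrite eB cat_rcons.
by case=> [|j] /=; rewrite ?addn0 // => /hr; rewrite size_rcons addSnnS.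
Qed.

Lemma put_dots_two n (C1 C2 : seq nat) : put_dots n (two_tab C1 C2) =
  two_tab [seq if x == n then 0 else x | x <- C1] [seq if x == n then 0 else x | x <- C2].
Proof.
by rewrite /put_dots /two_tab map_cons_col -!map_comp.
Qed.

Lemma two_column_max n s : sorted ltn s -> in_range n s ->
  exists D, all (fun x => x < n) D /\ s = D ++ nseq (n \in s) n.
Proof.
move=> hs hr; case: (boolP (n \in s)) => hn.
  have [|D -> hD] := sorted_ltn_max hs _ hn; first by apply: sub_all hr => x /andP[].
  by exists D; rewrite cats1.
exists s; rewrite cats0; split=> //; apply/allP => x hx.
have := allP hr _ hx; have : x != n by apply: contraNneq hn => <-.
by lia.
Qed.

(* [V1] and [V2] are the columns after the slides, the dots being 0. *)
Definition two_slides_to (n : nat) (X : seq nat * seq nat) V1 V2 : Prop :=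
  let s0 := [seq x <- iota 1 n.-1 | mult X x == 1] in
  [/\ slide_dots n (two_tab X.1 X.2) = two_tab V1 V2,
      two_good n (map S V1, map S V2),
      perm_eq (V1 ++ V2) [seq if x == n then 0 else x | x <- X.1 ++ X.2]
    & (if mult X n == 1 then [:: 0 \in V1] else [::]) ++
        [seq x \in V1 | x <- s0] =
      if mult X n == 1 then
        ballot_promotion (rcons [seq x \in X.1 | x <- s0] (n \in X.1))
      else [seq x \in X.1 | x <- s0]].

Lemma two_promotion_of_slides n X V1 V2 : 0 < n -> two_good n X ->
  two_slides_to n X V1 V2 -> exists Y,
  [/\ two_good n Y, promotion n (two_tab X.1 X.2) = two_tab Y.1 Y.2,
      forall x, 0 < x < n -> mult Y x.+1 = mult X x, mult Y 1 = mult X n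
    & two_code n Y =
      if mult X n == 1 then ballot_promotion (two_code n X) else two_code n X].
Proof.
move=> n0 gX [es gY hp hc]; pose Y := (map S V1, map S V2).
have rw : in_range n (X.1 ++ X.2) by rewrite /in_range all_cat; apply/andP; case: gX.
have [m1 m2] : (forall x, 0 < x < n -> mult Y x.+1 = mult X x) /\
    mult Y 1 = mult X n.
  by rewrite /mult /= -map_cat; apply: count_mem_rotate.
have SK : injective S by move=> ? ? [].
exists Y; split=> //.
  by rewrite /promotion es /two_tab map_cons_col -!map_comp.
rewrite /two_code /two_singles (filter_iota_last (fun x => mult X x == 1) n0).
rewrite (@filter_iota_rotate (fun x => mult X x == 1) (fun x => mult Y x == 1) n) //;
  last 2 first.
- by move=> x hx; rewrite m1.
- by rewrite m2.
set s0 := filter _ (iota 1 n.-1) in hc *.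
have eV : [seq x \in Y.1 | x <- map S s0] = [seq x \in V1 | x <- s0].
  by rewrite -map_comp; apply: eq_map => x /=; rewrite mem_map.
rewrite map_cat eV; case: ifP hc => _ /=; last by rewrite cats0.
by rewrite cats1 map_rcons mem_map.
Qed.

Lemma sorted_ltn_cons0 s : all (ltn 0) s -> sorted ltn s -> sorted ltn (0 :: s).
Proof. by move=> h o; rewrite /= path_sortedE ?h //; exact: ltn_trans. Qed.

Lemma nth_sorted_ltn s i j : sorted ltn s -> i < j < size s -> nth 0 s i < nth 0 s j.
Proof.
by move=> hs hj; apply: (sorted_ltn_nth ltn_trans) => //; rewrite ?inE; lia.
Qed.

Lemma in_range_neq n x : 0 < x < n -> (x == 0) = false /\ (x == n) = false.
Proof. by case/andP=> h1 h2; rewrite gtn_eqF // ltn_eqF. Qed.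

Lemma slide_dotS k T r c : slide_dot k.+1 T r c =
  if (entry_above T r c == 0) && (entry_left T r c == 0) then T
  else if entry_left T r c <= entry_above T r c then
    slide_dot k (set_entry (set_entry T r c (entry_above T r c)) r.-1 c 0) r.-1 c
  else slide_dot k (set_entry (set_entry T r c (entry_left T r c)) r c.-1 0) r c.-1.
Proof. by []. Qed.

(** * Promotion of two columns, according to which of them contain n *)

Section TwoSlides.

Variables (n : nat) (X : seq nat * seq nat).
Hypotheses (n0 : 0 < n) (gX : two_good n X).

Let s0 := [seq x <- iota 1 n.-1 | mult X x == 1].

Lemma two_positive : all (ltn 0) X.1 /\ all (ltn 0) X.2.
Proof.
by case: gX => _ _ _ _ r1 r2 _; split; [apply: sub_all r1|apply: sub_all r2] => x /andP[].
Qed.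

Lemma mem_s0_range x : x \in s0 -> 0 < x < n.
Proof. by rewrite mem_filter mem_iota; clear; lia. Qed.

Lemma two_slides00 : n \notin X.1 -> n \notin X.2 -> two_slides_to n X X.1 X.2.
Proof.
move=> h1 h2; have [z1 z2 o1 o2 r1 r2 hr] := gX.
have lt C : in_range n C -> n \notin C -> all (fun x => x < n) C.
  move=> hC nC; apply/allP => x hx; have := allP hC _ hx.
  have : x != n by apply: contraNneq nC => <-.
  by clear; lia.
have mn : mult X n = 0 by rewrite (two_mult _ gX) (negPf h1) (negPf h2).
have l1 := lt _ r1 h1; have l2 := lt _ r2 h2.
split; rewrite ?mn //.
- rewrite /slide_dots (@two_dot_cells n X 0 0 X.1 X.2) ?cats0 //=.
  by rewrite put_dots_two !put_dots_lt.
- exact: two_good_shift.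
- by rewrite put_dots_lt // all_cat l1.
Qed.

(** The dot never leaves the first column, which moves down and so only gets smaller in each row;
    the last letter [true] of the word goes to the front. *)
Lemma two_slides10 D : X.1 = D ++ [:: n] -> all (fun x => x < n) D ->
  n \notin X.2 -> all (fun x => x < n) X.2 -> two_slides_to n X (0 :: D) X.2.
Proof.
move=> e1 l1 h2 l2; have [z1 z2 o1 o2 r1 r2 hr] := gX.
have [p1 p2] := two_positive.
have pD : all (ltn 0) D by move: p1; rewrite e1 all_cat => /andP[].
have oD : sorted ltn D by move: o1; rewrite e1 => /cat_sorted2[].
have nD : n \notin D by apply/negP => /(allP l1); rewrite ltnn.
have mn : mult X n = 1.
  by rewrite (two_mult _ gX) (negPf h2) e1 mem_cat inE eqxx orbT.
split; rewrite ?mn //.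
- rewrite /slide_dots (@two_dot_cells n X 1 0 D X.2) ?cats0 //=.
  rewrite put_dots_two e1 map_cat (put_dots_lt l1) (put_dots_lt l2) /= eqxx.
  by rewrite addn0 /two_tab slide_dot_col0 ?cats0.
- apply: two_good_shift => //=.
  + by move: z2; rewrite e1 size_cat addn1.
  + exact: sorted_ltn_cons0.
  + by rewrite n0.
  + case=> //= j hj; have hjD : j < size D by move: z2 hj; rewrite e1 size_cat /=; clear; lia.
    have := hr j (ltnW hj); rewrite e1 nth_cat hjD => h.
    by apply: leq_trans h _; apply/ltnW/nth_sorted_ltn => //; rewrite ltnSn.
- rewrite e1 !map_cat (put_dots_lt l1) (put_dots_lt l2) /= eqxx.
  by apply/permP => p; rewrite /= !count_cat /=; clear; lia.
have nX : n \in X.1 by rewrite e1 mem_cat inE eqxx orbT.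
rewrite /= ballot_promotion_rcons nX; congr cons.
apply/eq_in_map => x /mem_s0_range hx; rewrite e1 mem_cat !inE.
have [-> ->] := in_range_neq hx.
by rewrite orbF.
Qed.

(** The first dot has pushed its column down by one, so the second dot compares entries of the same
    original row and always goes up. It ends beside the first dot, which reads as 0 and stops it. *)
Lemma two_slides11 D1 D2 : X.1 = D1 ++ [:: n] -> all (fun x => x < n) D1 ->
  X.2 = D2 ++ [:: n] -> all (fun x => x < n) D2 ->
  two_slides_to n X (0 :: D1) (0 :: D2).
Proof.
move=> e1 l1 e2 l2; have [z1 z2 o1 o2 r1 r2 hr] := gX.
have [p1 p2] := two_positive.
have pD1 : all (ltn 0) D1 by move: p1; rewrite e1 all_cat => /andP[].
have oD1 : sorted ltn D1 by move: o1; rewrite e1 => /cat_sorted2[].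
have nD1 : n \notin D1 by apply/negP => /(allP l1); rewrite ltnn.
have pD2 : all (ltn 0) D2 by move: p2; rewrite e2 all_cat => /andP[].
have oD2 : sorted ltn D2 by move: o2; rewrite e2 => /cat_sorted2[].
have nD2 : n \notin D2 by apply/negP => /(allP l2); rewrite ltnn.
have mn : mult X n = 2.
  by rewrite (two_mult _ gX) e1 e2 !mem_cat !inE eqxx !orbT.
have sD : size D2 <= size D1 by move: z2; rewrite e1 e2 !size_cat /=; clear; lia.
have hD j : j < size D2 -> nth 0 D1 j <= nth 0 D2 j.
  move=> hj; have := hr j; rewrite e1 e2 !nth_cat size_cat hj (leq_trans hj sD).
  by apply; rewrite /= addn1 ltnW.
split; rewrite ?mn //.
- rewrite /slide_dots (@two_dot_cells n X 1 1 D1 D2) //=.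
  rewrite put_dots_two e1 e2 !map_cat (put_dots_lt l1) (put_dots_lt l2) /= eqxx.
  rewrite addn0 {1}/two_tab slide_dot_col0 ?cats0 // -/(two_tab _ _) addnC.
  have := @slide_dot_col1 1 (0 :: D1) [::] D2 [::]; rewrite /= cats0 => -> //.
  by rewrite size_cat addn1.
- apply: two_good_shift; rewrite //= ?n0 //.
  + exact: sorted_ltn_cons0.
  + exact: sorted_ltn_cons0.
  by case=> //= j; exact: hD.
- rewrite e1 e2 !map_cat (put_dots_lt l1) (put_dots_lt l2) /= eqxx.
  by apply/permP => p; rewrite /= !count_cat /=; clear; lia.
apply/eq_in_map => x /mem_s0_range hx; rewrite e1 mem_cat !inE.
have [-> ->] := in_range_neq hx.
by rewrite orbF.
Qed.

(** The dot climbs past [B2], turns left at [x], and climbs past [A1] to the top. Only [x] changes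
    column, so one bit becomes [false], and the new entry 1 adds [true] in front. *)
Lemma two_slides01 D : n \notin X.1 -> all (fun x => x < n) X.1 ->
  X.2 = D ++ [:: n] -> all (fun x => x < n) D ->
  exists V1 V2, two_slides_to n X V1 V2.
Proof.
move=> h1 l1 e2 l2; have [z1 z2 o1 o2 r1 r2 hr] := gX.
have [p1 p2] := two_positive.
have pD : all (ltn 0) D by move: p2; rewrite e2 all_cat => /andP[].
have oD : sorted ltn D by move: o2; rewrite e2 => /cat_sorted2[].
have nD : n \notin D by apply/negP => /(allP l2); rewrite ltnn.
have mn : mult X n = 1.
  by rewrite (two_mult _ gX) e2 mem_cat inE eqxx orbT (negPf h1).
have [|A1 [x [A2 [B1 [B2 [e1 eD sA hx hB]]]]]] := @two_slide_split X.1 D p1.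
  by move: z2; rewrite e2 size_cat /= addn1.
have xn : x < n by apply: (allP l1); rewrite e1 mem_cat mem_head orbT.
have x0 : 0 < x by apply: (allP p1); rewrite e1 mem_cat mem_head orbT.
have sB : size B2 <= size A2.
  by move: z2; rewrite e1 e2 eD !size_cat /= sA; clear; lia.
have /andP[xA1 xA2] : all (fun y => y < x) A1 && all (fun y => x < y) A2.
  move: o1; rewrite e1 sorted_pairwise; last exact: ltn_trans.
  rewrite pairwise_cat allrel_consr => /and3P[/andP[h _] _].
  by rewrite pairwise_cons => /andP[h' _]; apply/andP.
have oA : sorted ltn (A1 ++ A2).
  move: o1; rewrite e1; apply: subseq_sorted; first exact: ltn_trans.
  by rewrite cat_subseq // subseq_cons.
have /andP[oB1 oB2] : sorted ltn B1 && sorted ltn B2.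
  by move: oD; rewrite eD => /cat_sorted2[-> ->].
have xB1 : all (fun y => y < x) B1.
  apply/allP => y; case/lastP: B1 hx oB1 {eD sA} => // B b; rewrite last_rcons => hb.
  rewrite sorted_pairwise -?cats1 ?pairwise_cat ?allrel1r; last exact: ltn_trans.
  case/andP=> /allP hB' _; rewrite mem_cat inE => /orP[/hB' /= h|/eqP-> //].
  exact: ltn_trans hb.
have xB2 : all (fun y => x < y) B2.
  apply/(all_nthP 0) => j hj; apply: leq_trans (hB _ hj).
  by apply: (all_nthP 0 xA2); exact: leq_trans sB.
have nxB2 : ~~ (x \in B2) by apply/negP => /(allP xB2); rewrite ltnn.
have nxB1 : ~~ (x \in B1) by apply/negP => /(allP xB1); rewrite ltnn.
have nxA2 : ~~ (x \in A2) by apply/negP => /(allP xA2); rewrite ltnn.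
have nxA1 : ~~ (x \in A1) by apply/negP => /(allP xA1); rewrite ltnn.
(* [x] lies strictly between [B1] and [B2], hence is missing from the second column and has
   multiplicity one. *)
have xs0 : x \in s0.
  rewrite mem_filter mem_iota (two_mult _ gX) e2 eD e1 !mem_cat !inE eqxx.
  rewrite (negPf nxB1) (negPf nxB2) (ltn_eqF xn) orbT /=; move: x0 xn; clear; lia.
have sAx : size A1 < size X.1 by rewrite e1 size_cat /=; clear; lia.
exists (0 :: A1 ++ A2), (B1 ++ x :: B2); split; rewrite ?mn //.
- rewrite /slide_dots (@two_dot_cells n X 0 1 X.1 D) ?cats0 //.
  rewrite put_dots_two (put_dots_lt l1) e2 map_cat (put_dots_lt l2) /= eqxx.
  have -> : size D + 1 = (size B1).+1 + size B2 by rewrite eD size_cat; clear; lia.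
  have -> : size D = size B1 + size B2 by rewrite eD size_cat.
  rewrite eD -catA slide_dot_col1; last 3 first.
  + by move: z2; rewrite e2 eD !size_cat addnA.
  + by move: pD; rewrite eD all_cat => /andP[].
  + move=> j hj; rewrite e1 nth_cat sA ltnNge -addnS leq_addr /= addKn.
    exact: hB.
  set T := two_tab _ _.
  have sT : size (B1 ++ 0 :: B2 ++ [::]) <= size X.1.
    by move: z2; rewrite e2 eD cats0 !size_cat /=; clear; lia.
  have ea : entry_above T (size B1) 1 = last 0 B1.
    rewrite /T; case/lastP: (B1) sT => // B b sT.
    by rewrite size_rcons last_rcons /= entry_two1 // cat_rcons nth_cat ltnn subnn.
  have el : entry_left T (size B1) 1 = x.
    by rewrite /= entry_cons_col0 e1 nth_cat sA ltnn subnn.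
  rewrite slide_dotS ea el (gtn_eqF x0) andbF leqNgt hx /=.
  rewrite set_entry_two1 //; last by rewrite size_cat /=; clear; lia.
  rewrite set_nth_cat_size cats0 -sA set_entry_cons_col0 //.
  rewrite e1 set_nth_cat_size slide_dot_col0 //.
  by move: p1; rewrite e1 all_cat => /andP[].
- apply: two_good_shift.
  + by rewrite size_cat /=; clear; lia.
  + by move: z2; rewrite e1 e2 eD !size_cat /= size_cat sA; clear; lia.
  + apply: sorted_ltn_cons0 => //; move: p1; rewrite e1 !all_cat /=.
    by case/and3P=> -> _ ->.
  + rewrite sorted_pairwise; last exact: ltn_trans.
    rewrite pairwise_cat pairwise_cons -!sorted_pairwise; try exact: ltn_trans.
    rewrite oB1 oB2 xB2 !andbT allrel_consr xB1 /=; apply/allrelP => y z hy hz.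
    exact: ltn_trans (allP xB1 _ hy) (allP xB2 _ hz).
  + rewrite /= n0 all_cat; move: l1; rewrite e1 !all_cat /=.
    by case/and3P=> -> _ ->.
  + rewrite all_cat /= xn; move: l2; rewrite eD all_cat /=.
    by case/andP=> -> ->.
  (* Down to the row of [x] the first column has been pushed down, so its entries have not
     increased; below that row nothing has moved in it. *)
  have hle j : j <= size A1 -> nth 0 (0 :: A1 ++ A2) j <= nth 0 X.1 j.
    case: j => // j hj /=; rewrite nth_cat hj.
    have -> : nth 0 A1 j = nth 0 X.1 j by rewrite e1 nth_cat hj.
    by apply/ltnW/nth_sorted_ltn => //; rewrite ltnSn (leq_ltn_trans hj).
  move=> j; rewrite size_cat /= => hj; rewrite [nth 0 (B1 ++ _) _]nth_cat.
  have [jB|jB] := ltnP j (size B1).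
    apply: leq_trans (hle _ _) _; first by rewrite sA ltnW.
    have := hr j; rewrite e2 eD -catA nth_cat jB; apply.
    by move: hj; rewrite !size_cat /=; clear; lia.
  have [t ej] : exists t, j = size B1 + t by exists (j - size B1); rewrite subnKC.
  rewrite ej addKn; case: t ej => [|t] ej /=.
    rewrite addn0 -sA; apply: leq_trans (hle _ (leqnn _)) _.
    by rewrite e1 nth_cat ltnn subnn.
  rewrite addnS /= nth_cat -sA ltnNge leq_addr /= addKn; apply: hB.
  by move: hj; rewrite ej; clear; lia.
- rewrite e1 e2 eD !map_cat /=.
  move: l1 l2; rewrite e1 eD !all_cat /= => /and3P[lA1 _ lA2] /andP[lB1 lB2].
  rewrite !put_dots_lt // eqxx (ltn_eqF xn).
  by apply/permP => p; rewrite /= !count_cat /=; clear; lia.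
rewrite ballot_promotion_rcons (negPf h1) /=; congr cons.
set g := [seq y \in X.1 | y <- s0].
have os0 : sorted ltn s0 by apply: sorted_filter; [exact: ltn_trans|exact: iota_ltn_sorted].
have us0 : uniq s0 := sorted_uniq ltn_trans ltnn os0.
have cnt1 y : count (fun z => z < y) X.1 = count (fun z => z < y) A1 + ((x < y) + count (fun z => z < y) A2).
  by rewrite e1 count_cat.
have cnt2 y : y \in s0 -> count (fun z => z < y) X.2 = count (fun z => z < y) B1 + count (fun z => z < y) B2.
  move=> /mem_s0_range hy; rewrite e2 eD !count_cat /= (_ : n < y = false) ?addn0 //.
  by apply/negbTE; rewrite -leqNgt; case/andP: hy => _ /ltnW.
have lt_all y C : all (fun z => z < x) C -> x <= y -> count (fun z => z < y) C = size C.
  move=> hC hxy; apply/eqP; rewrite -all_count; apply: sub_all hC => z hz.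
  exact: leq_trans hxy.
have lt_none C : all (fun z => x < z) C -> count (fun z => z < x) C = 0.
  move=> hC; apply/eqP; rewrite -leqn0 leqNgt -has_count; apply/hasPn => z /(allP hC).
  by rewrite -leqNgt => /ltnW.
(* Below [x] the columns contribute [A1] and [B1], of equal length. Past [x] the first column leads
   by one, and the rows of [A2] and [B2] preserve this lead, so no later prefix is balanced. *)
have ex : last_balanced g = index x s0.
  apply: last_filter_iota.
  - by rewrite size_map index_mem.
  - rewrite (balanced_take gX) // cnt1 cnt2 // ltnn (lt_none _ xA2) (lt_none _ xB2).
    by rewrite (lt_all _ _ xA1) // (lt_all _ _ xB1) // sA.
  move=> k; rewrite size_map => /andP[k1 k2].
  have hy : nth 0 s0 k \in s0 by exact: mem_nth.
  have xy : x < nth 0 s0 k.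
    rewrite -{1}(nth_index 0 xs0); apply: nth_sorted_ltn => //.
    by rewrite k1.
  have := balanced_take gX hy; rewrite index_uniq // -/s0 -/g => ->.
  rewrite cnt1 cnt2 // (lt_all _ _ xA1 (ltnW xy)) (lt_all _ _ xB1 (ltnW xy)) xy sA.
  have := count_lt_rows (nth 0 s0 k) sB hB.
  by rewrite eqn_add2l /= add1n => h; rewrite gtn_eqF.
rewrite ex; apply: (@eq_from_nth _ false).
  rewrite size_set_nth !size_map; apply/esym/maxn_idPr.
  by rewrite index_mem.
rewrite size_map => k hk; rewrite nth_set_nth /= /g !(nth_map 0) //.
have := mem_s0_range (mem_nth 0 hk); set y := nth 0 s0 k => hy.
have -> : (k == index x s0) = (y == x).
  apply/eqP/eqP => [e|e]; first by rewrite /y e nth_index.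
  by rewrite -e /y index_uniq.
rewrite inE mem_cat e1 mem_cat inE.
have [-> _] := in_range_neq hy.
have [->|_] /= := eqVneq y x; last by [].
by rewrite (negPf nxA1) (negPf nxA2).
Qed.

End TwoSlides.

Lemma two_promotion n X : 0 < n -> two_good n X -> exists Y,
  [/\ two_good n Y, promotion n (two_tab X.1 X.2) = two_tab Y.1 Y.2,
      forall x, 0 < x < n -> mult Y x.+1 = mult X x, mult Y 1 = mult X n
    & two_code n Y =
      if mult X n == 1 then ballot_promotion (two_code n X) else two_code n X].
Proof.
move=> n0 gX.
suff [V1 [V2 hV]] : exists V1 V2, two_slides_to n X V1 V2.
  exact: two_promotion_of_slides hV.
have [D1 [l1 e1]] := two_column_max (two_sorted1 gX) (two_range1 gX).
have [D2 [l2 e2]] := two_column_max (two_sorted2 gX) (two_range2 gX).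
case: (boolP (n \in X.1)) e1 => h1 e1; case: (boolP (n \in X.2)) e2 => h2 e2.
- by exists (0 :: D1), (0 :: D2); apply: two_slides11.
- by exists (0 :: D1), X.2; apply: two_slides10 => //; rewrite e2 cats0.
- by apply: two_slides01 e2 l2 => //; rewrite e1 cats0.
- by exists X.1, X.2; apply: two_slides00.
Qed.

(** * Reflections of two columns *)

Lemma reading_word_two_cons (X : Type) (a b : X) C1 C2 :
  flatten (rev (two_tab (a :: C1) (b :: C2))) =
  flatten (rev (two_tab C1 C2)) ++ [:: a; b].
Proof. by rewrite /two_tab /= rev_cons flatten_rcons. Qed.

Lemma reading_word_two_nil (X : Type) (C1 : seq X) :
  flatten (rev (two_tab C1 [::])) = rev C1.
Proof.
elim: C1 => //= a C1 IH; rewrite /two_tab /= rev_cons flatten_rcons rev_cons.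
by rewrite -cats1 -IH.
Qed.

Lemma count_reading_word_two (C1 C2 : seq nat) p : size C2 <= size C1 ->
  count p (reading_word (two_tab C1 C2)) = count p (C1 ++ C2).
Proof.
rewrite /reading_word; elim: C1 C2 => [|a C1 IH] [|b C2] //.
  by move=> _; rewrite reading_word_two_nil count_rev cats0.
rewrite /= ltnS => /IH; rewrite reading_word_two_cons !count_cat /= => ->.
by clear; lia.
Qed.

(* [false] tags the entries of the first column and [true] those of the second. *)
Definition tagged_reading (i : nat) (C1 C2 : seq nat) : seq (bool * nat) :=
  [seq x <- flatten (rev (two_tab [seq (false, a) | a <- C1] [seq (true, b) | b <- C2]))
  | letter i x.2].

Lemma tagged_reading_cons i a b C1 C2 :
  tagged_reading i (a :: C1) (b :: C2) = tagged_reading i C1 C2 ++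
    (if letter i a then [:: (false, a)] else [::]) ++
    (if letter i b then [:: (true, b)] else [::]).
Proof.
rewrite /tagged_reading /= reading_word_two_cons filter_cat /=.
by case: (letter i a); case: (letter i b).
Qed.

Lemma tagged_reading_neutral2 i C1 C2 : filter (letter i) C2 = [::] ->
  size C2 <= size C1 ->
  tagged_reading i C1 C2 = [seq (false, a) | a <- rev (filter (letter i) C1)].
Proof.
elim: C1 C2 => [|a C1 IH] [|b C2] //.
  move=> _ _; rewrite /tagged_reading reading_word_two_nil filter_rev filter_map.
  by rewrite map_rev.
rewrite tagged_reading_cons [filter _ (b :: _)]/=; case: (letter i b) => // h hs.
rewrite IH //= cats0; case: (letter i a); last by rewrite cats0.
by rewrite rev_cons map_rcons cats1.
Qed.

Lemma filter_letter_head i b C : sorted ltn (b :: C) -> ~~ letter i b ->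
  filter (letter i) C != [::] -> b < i.
Proof.
rewrite /= path_sortedE; last exact: ltn_trans.
case/andP=> /allP hb _ nb; rewrite -has_filter => /hasP[x /hb /= hx].
by move: nb; rewrite /letter; move: hx; clear; lia.
Qed.

(** [y] cannot stand below the row of [i]: the right neighbour of [i] would be at least [i] and less
    than [y], hence a second letter in the second column. *)
Lemma tagged_reading_full1 i y C1 C2 : sorted ltn C1 -> sorted ltn C2 ->
  size C2 <= size C1 -> (forall j, j < size C2 -> nth 0 C1 j <= nth 0 C2 j) ->
  filter (letter i) C1 = [:: i; i.+1] -> filter (letter i) C2 = [:: y] ->
  tagged_reading i C1 C2 = [:: (false, i.+1); (false, i); (true, y)].
Proof.
elim: C1 C2 => [|a C1 IH] [|b C2] // o1 o2 hs hr.
have hab : a <= b := hr 0 isT.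
have hr' j : j < size C2 -> nth 0 C1 j <= nth 0 C2 j by exact: (hr j.+1).
rewrite tagged_reading_cons /=; case ha: (letter i a); case hb: (letter i b) => //.
- move=> [ea e1] [eb e2].
  by rewrite tagged_reading_neutral2 // e1 ea eb.
- move=> [ea _] e2; have := @filter_letter_head i b C2 o2; rewrite hb e2.
  by move=> /(_ isT isT); rewrite ltnNge -{1}ea hab.
- move=> e1 [eb e2]; by rewrite tagged_reading_neutral2 // e1 eb.
- by move=> e1 e2; rewrite !cats0; apply: IH => //; [exact: path_sorted o1|exact: path_sorted o2].
Qed.

(** [y] cannot stand above the row of [i.+1]: the left neighbour of [i.+1] would exceed [y] and be
    at most [i.+1], hence a second letter in the first column. *)
Lemma tagged_reading_full2 i y C1 C2 : sorted ltn C1 -> sorted ltn C2 ->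
  size C2 <= size C1 -> (forall j, j < size C2 -> nth 0 C1 j <= nth 0 C2 j) ->
  filter (letter i) C1 = [:: y] -> filter (letter i) C2 = [:: i; i.+1] ->
  tagged_reading i C1 C2 = [:: (false, y); (true, i.+1); (true, i)].
Proof.
elim: C1 C2 => [|a C1 IH] [|b C2] // o1 o2 hs hr.
have hab : a <= b := hr 0 isT.
have hr' j : j < size C2 -> nth 0 C1 j <= nth 0 C2 j by exact: (hr j.+1).
rewrite tagged_reading_cons /=; case ha: (letter i a); case hb: (letter i b) => //; last first.
- by move=> e1 e2; rewrite !cats0; apply: IH => //; [exact: path_sorted o1|exact: path_sorted o2].
- move=> e1 [eb e2].
  case: C2 o2 hs hr' e2 {IH hr} => // b' C2 /= /andP[hbb o2] hs hr'.
  case: C1 e1 o1 hs hr' => // a' C1 /= e1 o1 hs hr'.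
  case hb': (letter i b') => e2; last first.
    have := @filter_letter_head i b' C2 o2; rewrite hb' e2 => /(_ isT isT).
    by move: hbb; rewrite eb; clear; lia.
  case: e2 => eb' e2; rewrite tagged_reading_cons hb'.
  move: e1; case: (letter i a') => e1.
    case: e1 => -> e1; rewrite tagged_reading_neutral2 // e1 /= eb eb'.
    by [].
  by rewrite tagged_reading_neutral2 // e1 /= eb eb'.
- move=> [_ _] e2; have := @filter_letter_head i b C2 o2; rewrite hb e2.
  by move=> /(_ isT isT); move: hab ha; rewrite /letter; clear; lia.
- move=> [ea e1] [eb e2].
  case: C2 o2 hs hr' e2 {IH hr} => // b' C2 /= /andP[hbb o2] hs hr'.
  case: C1 e1 o1 hs hr' => // a' C1 /= e1 /andP[haa o1] hs hr'.
  case hb': (letter i b') => e2; last first.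
    have := @filter_letter_head i b' C2 o2; rewrite hb' e2 => /(_ isT isT).
    by move: hbb; rewrite eb; clear; lia.
  case: e2 => eb' _; have := hr' 0 isT; move: e1; rewrite /= eb'.
  case: ifP => // hl _ hle; move: hl; rewrite /letter.
  by move: ha hab haa hle; rewrite eb /letter; clear; lia.
Qed.

(** Thanks to the tags, [psi] can exchange the letters in one column and leave the other fixed. *)
Lemma crystal_refl_two i (C1 C2 : seq nat) (psi : bool * nat -> nat) :
  (forall x, ~~ letter i x.2 -> psi x = x.2) ->
  reflect_word i (map snd (tagged_reading i C1 C2)) =
    map psi (tagged_reading i C1 C2) ->
  crystal_refl i (two_tab C1 C2) =
  two_tab [seq psi (false, a) | a <- C1] [seq psi (true, b) | b <- C2].
Proof.
move=> hpsi hw; pose U := two_tab [seq (false, a) | a <- C1] [seq (true, b) | b <- C2].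
have eU (h : bool * nat -> nat) : map (map h) U =
    two_tab [seq h (false, a) | a <- C1] [seq h (true, b) | b <- C2].
  by rewrite /U /two_tab map_cons_col -!map_comp.
have := eU snd; rewrite /= !map_id => <-; rewrite -eU.
apply: crystal_refl_eq.
  by rewrite /shape_of -!map_comp; apply: eq_map => r /=; rewrite !size_map.
rewrite /reading_word -!map_rev -!map_flatten.
exact: reflect_word_map.
Qed.

Lemma mem_swp_both i x (s : seq nat) : i \in s -> i.+1 \in s -> (swp i x \in s) = (x \in s).
Proof.
move=> h1 h2; have [->|n1] := eqVneq x i; first by rewrite swpl h1 h2.
have [->|n2] := eqVneq x i.+1; first by rewrite swpr h1 h2.
by rewrite swp_id // /letter negb_or n1.
Qed.

Lemma mem_map_swp i x (s : seq nat) : (x \in map (swp i) s) = (swp i x \in s).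
Proof. by rewrite -{1}(swpK i x) mem_map //; exact: swp_inj. Qed.

Lemma reflect_three_full1 i y : letter i y ->
  reflect_word i [:: i.+1; i; y] = [:: i.+1; i; swp i y].
Proof.
case/orP=> /eqP->.
  by rewrite swpl; exact: (reflect_pair_close_open i 1 0).
by rewrite swpr; exact: (reflect_pair_close_open i 0 1).
Qed.

Lemma reflect_three_full2 i y : letter i y ->
  reflect_word i [:: y; i.+1; i] = [:: swp i y; i.+1; i].
Proof.
have h1 : (i == i.+1) = false by rewrite ltn_eqF.
case/orP=> /eqP->; rewrite ?swpl ?swpr /reflect_word /=.
  by rewrite !(h1, eqxx).
by rewrite !(h1, eqxx).
Qed.

Lemma two_code_swp n i X Y : 0 < i < n -> 
  (forall x, mult Y x = mult X (swp i x)) ->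
  ~~ ((mult X i == 1) && (mult X i.+1 == 1)) ->
  (forall x, (swp i x \in Y.1) = (x \in X.1)) -> two_code n Y = two_code n X.
Proof.
move=> hi hmu hb h1; rewrite /two_code /two_singles.
rewrite (eq_filter (a2 := fun x => mult X (swp i x) == 1)); last by move=> x; rewrite hmu.
rewrite (@filter_swp_iota i n (fun x => mult X x == 1)) //.
by rewrite -map_comp; apply: eq_map => x /=.
Qed.

Section TwoReflection.

Variables (n i : nat) (X : seq nat * seq nat).
Hypotheses (hi : 0 < i < n) (gX : two_good n X).

Lemma in_range_swp s : in_range n s -> in_range n (map (swp i) s).
Proof.
move=> /allP h; apply/allP => y /mapP[x /h hx ->]; rewrite /swp.
by move: hi hx; clear; do 2?case: eqP; lia.
Qed.

Lemma two_refl_disjoint : ~~ ((0 < mult X i) && (0 < mult X i.+1)) ->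
  let Y := (map (swp i) X.1, map (swp i) X.2) in
  two_good n Y /\ crystal_refl i (two_tab X.1 X.2) = two_tab Y.1 Y.2.
Proof.
rewrite !mult_gt0 => hb Y; have [z1 z2 o1 o2 r1 r2 hr] := gX.
have hX1 : ~~ ((i \in X.1) && (i.+1 \in X.1)).
  by apply: contra hb => /andP[-> ->].
have hX2 : ~~ ((i \in X.2) && (i.+1 \in X.2)).
  by apply: contra hb => /andP[-> ->]; rewrite !orbT.
split.
  split; rewrite ?size_map ?in_range_swp //; try (by apply: sorted_swp => //; right).
  move=> j hj; rewrite !(nth_map 0) //; last exact: leq_trans z2.
  have m1 : nth 0 X.1 j \in X.1 by apply/mem_nth/(leq_trans hj).
  have m2 : nth 0 X.2 j \in X.2 by apply/mem_nth.
  have : ~~ ((nth 0 X.1 j == i) && (nth 0 X.2 j == i.+1)).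
    by apply: contra hb => /andP[/eqP <- /eqP <-]; rewrite m1 m2 orbT.
  move: (hr j hj); move: (nth 0 X.1 j) (nth 0 X.2 j) => a b; clear.
  by rewrite /swp; do 4?case: eqP; lia.
apply: (@crystal_refl_two i X.1 X.2 (fun x => swp i x.2)) => [x|]; first exact: swp_id.
rewrite reflect_word_swp -?map_comp //; apply: contra hb.
have sub x : x \in map snd (tagged_reading i X.1 X.2) -> (x \in X.1) || (x \in X.2).
  case/mapP=> t; rewrite mem_filter => /andP[_] /(map_f snd).
  rewrite map_flatten map_rev /two_tab map_cons_col -!map_comp /= map_id => ht ->.
  have := count_reading_word_two (pred1 t.2) z2; rewrite /reading_word.
  by rewrite -mem_cat -!has_pred1 !has_count => <-; rewrite -has_count has_pred1.
by move=> /andP[/sub -> /sub ->].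
Qed.

Lemma two_refl_full1 y : i \in X.1 -> i.+1 \in X.1 -> letter i y ->
  filter (letter i) X.2 = [:: y] ->
  let Y := (X.1, map (swp i) X.2) in
  two_good n Y /\ crystal_refl i (two_tab X.1 X.2) = two_tab Y.1 Y.2.
Proof.
move=> h1 h2 hy e2 Y; have [z1 z2 o1 o2 r1 r2 hr] := gX.
have e1 : filter (letter i) X.1 = [:: i; i.+1].
  by rewrite filter_letter_strict // h1 h2.
have hX2 : ~~ ((i \in X.2) && (i.+1 \in X.2)).
  by move: e2; rewrite filter_letter_strict //; do 2!case: (_ \in X.2).
split.
  split; rewrite ?size_map ?in_range_swp //; first by apply: sorted_swp => //; right.
  move=> j hj; rewrite (nth_map 0) //=.
  have hjr := hr j hj; have hj1 : j < size X.1 := leq_trans hj z2.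
  have [e|ne] := eqVneq (nth 0 X.2 j) i.+1; last first.
    by apply: leq_trans hjr _; move: ne; rewrite /swp; clear; do 2?case: eqP; lia.
  (* The only danger is a row with [i.+1] twice. The [i] of the first column is then higher up,
     which forces [i] in the second column one row above, so that this column contains both
     letters. *)
  rewrite e swpr leqNgt; apply/negP => hlt.
  have e' : nth 0 X.1 j = i.+1 by move: hjr hlt; rewrite e; clear; lia.
  have hk : index i X.1 < j.
    rewrite ltnNge; apply/negP; rewrite leq_eqVlt => /orP[/eqP ek|hk].
      by move: e'; rewrite ek nth_index //; clear; lia.
    have := @nth_sorted_ltn X.1 j (index i X.1) o1.
    by rewrite hk index_mem h1 nth_index // e' => /(_ isT); clear; lia.
  case: j hj hjr hj1 e hlt e' hk => // j hj hjr hj1 e hlt e' hk.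
  have : i <= nth 0 X.1 j.
    move: hk; rewrite ltnS leq_eqVlt => /orP[/eqP <-|hk]; first by rewrite nth_index.
    rewrite -{1}(nth_index 0 h1) ltnW //; apply: nth_sorted_ltn => //.
    by rewrite hk ltnW.
  have := hr j (ltnW hj); have := @nth_sorted_ltn X.2 j j.+1 o2.
  rewrite ltnSn hj e => /(_ isT) a1 a2 a3.
  have ei : nth 0 X.2 j = i by move: a1 a2 a3; clear; lia.
  case/negP: hX2; rewrite -{1}ei -e !mem_nth //; exact: ltnW.
have := @crystal_refl_two i X.1 X.2 (fun x => if x.1 then swp i x.2 else x.2).
rewrite /= map_id; apply.
  by move=> [[] x] //= hx; rewrite swp_id.
rewrite (tagged_reading_full1 o1 o2 z2 hr e1 e2) /=.
exact: reflect_three_full1.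
Qed.

Lemma two_refl_full2 y : i \in X.2 -> i.+1 \in X.2 -> letter i y ->
  filter (letter i) X.1 = [:: y] ->
  let Y := (map (swp i) X.1, X.2) in
  two_good n Y /\ crystal_refl i (two_tab X.1 X.2) = two_tab Y.1 Y.2.
Proof.
move=> h1 h2 hy e1 Y; have [z1 z2 o1 o2 r1 r2 hr] := gX.
have e2 : filter (letter i) X.2 = [:: i; i.+1].
  by rewrite filter_letter_strict // h1 h2.
have hX1 : ~~ ((i \in X.1) && (i.+1 \in X.1)).
  by move: e1; rewrite filter_letter_strict //; do 2!case: (_ \in X.1).
split.
  split; rewrite ?size_map ?in_range_swp //; first by apply: sorted_swp => //; right.
  move=> j hj; have hj1 : j < size X.1 := leq_trans hj z2.
  rewrite (nth_map 0) //=; have hjr := hr j hj.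
  have [e|ne] := eqVneq (nth 0 X.1 j) i; last first.
    by apply: leq_trans hjr; move: ne; rewrite /swp; clear; do 2?case: eqP; lia.
  (* The only danger is a row with [i] twice. The [i.+1] of the second column is then lower down,
     which forces [i.+1] in the first column one row below, so that this column contains both
     letters. *)
  rewrite e swpl ltnNge; apply/negP => hle.
  have e' : nth 0 X.2 j = i by move: hjr hle; rewrite e; clear; lia.
  have hk : j < index i.+1 X.2.
    rewrite ltnNge; apply/negP; rewrite leq_eqVlt => /orP[/eqP ek|hk].
      by move: e'; rewrite -ek nth_index //; clear; lia.
    have := @nth_sorted_ltn X.2 (index i.+1 X.2) j o2.
    by rewrite hk hj nth_index // e' => /(_ isT); clear; lia.
  have hj' : j.+1 < size X.2 by apply: leq_ltn_trans hk _; rewrite index_mem.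
  have : nth 0 X.2 j.+1 <= i.+1.
    move: hk; rewrite leq_eqVlt => /orP[/eqP ->|hk]; first by rewrite nth_index.
    rewrite -[leqRHS](nth_index 0 h2) ltnW //; apply: nth_sorted_ltn => //.
    by rewrite hk index_mem.
  have hj1' := leq_trans hj' z2.
  have := hr j.+1 hj'; have := @nth_sorted_ltn X.1 j j.+1 o1.
  rewrite ltnSn hj1' e => /(_ isT) a1 a2 a3.
  have ei : nth 0 X.1 j.+1 = i.+1 by move: a1 a2 a3; clear; lia.
  by case/negP: hX1; rewrite -{1}e -ei !mem_nth.
have := @crystal_refl_two i X.1 X.2 (fun x => if x.1 then x.2 else swp i x.2).
rewrite /= map_id; apply.
  by move=> [[] x] //= hx; rewrite swp_id.
rewrite (tagged_reading_full2 o1 o2 z2 hr e1 e2) /=.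
exact: reflect_three_full2.
Qed.

(** Multiplicities are at most 2. If they are equal the tableau is fixed; if one is 0 the letters
    are renamed; otherwise they are 1 and 2, so one column has both letters and is fixed, while the
    single letter of the other is exchanged. *)
Lemma two_crystal_refl : exists Y,
  [/\ two_good n Y, crystal_refl i (two_tab X.1 X.2) = two_tab Y.1 Y.2,
      forall x, 0 < x <= n -> mult Y x = mult X (swp i x)
    & two_code n Y = two_code n X].
Proof.
have [o1 o2] := (two_sorted1 gX, two_sorted2 gX).
case: (eqVneq (mult X i) (mult X i.+1)) => [em|nm].
  exists X; split=> //.
    apply: crystal_refl_eq => //; apply: reflect_word_balanced.
    by rewrite !count_reading_word_two ?(two_size gX).
  move=> x _; have [->|n1] := eqVneq x i; first by rewrite swpl.
  have [->|n2] := eqVneq x i.+1; first by rewrite swpr.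
  by rewrite swp_id // /letter negb_or n1.
have n11 : ~~ ((mult X i == 1) && (mult X i.+1 == 1)).
  by apply: contra nm => /andP[/eqP-> /eqP->].
suff [Y [gY eY hmu h1]] : exists Y, [/\ two_good n Y,
    crystal_refl i (two_tab X.1 X.2) = two_tab Y.1 Y.2,
    forall x, mult Y x = mult X (swp i x) &
    forall x, (swp i x \in Y.1) = (x \in X.1)].
  by exists Y; split=> //; exact: (two_code_swp hi hmu n11 h1).
case: (boolP ((0 < mult X i) && (0 < mult X i.+1))) => hb; last first.
  have [gY eY] := two_refl_disjoint hb.
  exists (map (swp i) X.1, map (swp i) X.2); split=> // x.
    by rewrite (two_mult _ gY) (two_mult _ gX) !mem_map_swp.
  by rewrite mem_map_swp swpK.
have full1 : i \in X.1 -> i.+1 \in X.1 -> (i \in X.2) != (i.+1 \in X.2) ->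
    exists Y, [/\ two_good n Y,
    crystal_refl i (two_tab X.1 X.2) = two_tab Y.1 Y.2,
    forall x, mult Y x = mult X (swp i x) &
    forall x, (swp i x \in Y.1) = (x \in X.1)].
  move=> h1 h2 h3; pose y := if i \in X.2 then i else i.+1.
  have [||gY eY] := @two_refl_full1 y h1 h2.
  - by rewrite /y /letter; case: ifP; rewrite eqxx ?orbT.
  - by rewrite filter_letter_strict // /y; move: h3; do 2!case: (_ \in X.2).
  exists (X.1, map (swp i) X.2); split=> // x; last exact: mem_swp_both.
  by rewrite (two_mult _ gY) (two_mult _ gX) mem_map_swp (mem_swp_both x h1 h2).
have full2 : i \in X.2 -> i.+1 \in X.2 -> (i \in X.1) != (i.+1 \in X.1) ->
    exists Y, [/\ two_good n Y,
    crystal_refl i (two_tab X.1 X.2) = two_tab Y.1 Y.2,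
    forall x, mult Y x = mult X (swp i x) &
    forall x, (swp i x \in Y.1) = (x \in X.1)].
  move=> h1 h2 h3; pose y := if i \in X.1 then i else i.+1.
  have [||gY eY] := @two_refl_full2 y h1 h2.
  - by rewrite /y /letter; case: ifP; rewrite eqxx ?orbT.
  - by rewrite filter_letter_strict // /y; move: h3; do 2!case: (_ \in X.1).
  exists (map (swp i) X.1, X.2); split=> // x; last by rewrite mem_map_swp swpK.
  by rewrite (two_mult _ gY) (two_mult _ gX) mem_map_swp (mem_swp_both x h1 h2).
move: nm hb full1 full2; rewrite !(two_mult _ gX).
case: (i \in X.1); case: (i.+1 \in X.1); case: (i \in X.2); case: (i.+1 \in X.2) => //=;
  by move=> _ _ f1 f2; first [exact: f1|exact: f2].
Qed.

End TwoReflection.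

Lemma two_iter_promotion n la : 0 < n -> is_part la -> two_column_shape la ->
  (forall i : nat, 1 <= i <= n - 1 ->
     {in SST n la, crystal_refl i \o iter n (promotion n)
                   =1 iter n (promotion n) \o crystal_refl i})
  /\ {in SST n la, coxeter n \o iter n (promotion n)
                   =1 iter n (promotion n) \o coxeter n}.
Proof.
move=> n0 hp hla; have inj := @two_encoding_inj n.
have pr X (gX : two_good n X) := two_promotion n0 gX.
have rf i X (hi : 0 < i < n) (gX : two_good n X) := two_crystal_refl hi gX.
pose tab (X : seq nat * seq nat) : tableau := two_tab X.1 X.2.
split=> [i hi|] T /(SST_two hp hla) [X gX ->] /=.
  have hi' : 0 < i < n by move: hi; clear; lia.
  exact: (crystal_refl_iter_promotion (tab := tab) (act := fun m => m == 1) inj pr rf hi' gX).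
exact: (coxeter_iter_promotion (tab := tab) (act := fun m => m == 1) inj pr rf).
Qed.

Theorem lemma4p5 (n : nat) (la : seq nat)
    (hn : 2 <= n) (hpart : is_part la) (hlen : size la < n)
    (hshape : hook_shape la \/ two_column_shape la) :
  (forall i : nat, 1 <= i <= n - 1 ->
     {in SST n la, crystal_refl i \o iter n (promotion n)
                   =1 iter n (promotion n) \o crystal_refl i})
  /\ {in SST n la, coxeter n \o iter n (promotion n)
                   =1 iter n (promotion n) \o coxeter n}.
Proof.
have n0 : 0 < n := ltnW hn.
by case: hshape; [exact: hook_iter_promotion|exact: two_iter_promotion].
Qed.
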